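(* Fix $d,m\in\mathbb{N}$ and let $\mathcal{L}$ be the space of linear maps $\mathrm{Sym}^2\mathbb{R}^d\to\mathbb{R}^m$. Let $U$ be the set of $A\in\mathcal{L}$ such that \[ \operatorname{rank}\big(t\cdot A[e_i,e_j]\big)_{1\le i,j\le d}\ge 2\quad\text{for all } t\in\mathbb{R}^m\setminus\{0\}, \] and let $\tilde U$ be the set of $A\in\mathcal{L}$ such that for all $t\in\mathbb{R}^m\setminus\{0\}$, the symmetric matrix $\big(t\cdot A[e_i,e_j]\big)_{1\le i,j\le d}$ has at least two nonzero eigenvalues that share the same sign. Then $U$ and $\tilde U$ are open subsets of $\mathcal{L}$, and: (i) if $m\ge\binom{d+1}{2}$, then $U$ is empty; (ii) if $m<\binom{d+1}{2}$, then $U$ is nonempty; (iii) if $m>\binom{d}{2}$, then $U$ is not dense in $\mathcal{L}$; (iv) if $m\le\binom{d}{2}$, then $U$ is dense in $\mathcal{L}$, and its complement is contained in a proper algebraic subset of $\mathcal{L}$; (v) if $m>\binom{d}{2}$, then $\tilde U$ is empty; (vi) if $m>\binom{d-1}{2}$, then $\tilde U$ is not dense in $\mathcal{L}$; (vii) if $m\le\binom{d-1}{2}$, then $\tilde U$ is dense in $\mathcal{L}$, and its complement is contained in a proper algebraic subset of $\mathcal{L}$.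
   Context: $(e_i)$ is the standard basis of $\mathbb{R}^d$, $A[e_i,e_j]\in\mathbb{R}^m$ denotes $A$ applied to the symmetric product of $e_i$ and $e_j$, and $t\cdot A[e_i,e_j]$ is the dot product in $\mathbb{R}^m$. $\mathcal{L}$ is regarded as a finite-dimensional real vector space. *)

(* Defs.v *)
From HB Require Import structures.
From mathcomp Require Import all_boot all_order all_algebra.
From mathcomp Require Import all_classical all_reals all_analysis.
From mathcomp Require mpoly.
Set Implicit Arguments.
Unset Strict Implicit.
Unset Printing Implicit Defensive.
Import Order.TTheory GRing.Theory Num.Theory numFieldNormedType.Exports.
Local Open Scope classical_set_scope.
Local Open Scope ring_scope.

Section FiniteDimensional.
Variables (R : realType) (V : vectType R).

Definition coords (v : V) : 'rV[R]_(\dim {:V}) :=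
  \row_i coord (vbasis {:V}) i v.

(* V with its canonical topology, that of R^(dim V) read through coordinates
   (the same topology for every basis). *)
Definition fdspace : topologicalType := initial_topology coords.

Definition zero_locus (S : set (mpoly.mpoly (\dim {:V}) R)) : set V :=
  [set v | forall p, S p -> mpoly.meval (coords v ord0) p = 0].

Definition algebraic_subset (Z : set V) : Prop := exists S, Z = zero_locus S.

Definition proper_algebraic_subset (Z : set V) : Prop :=
  algebraic_subset Z /\ Z != setT.

End FiniteDimensional.

Section SymmetricMaps.
Variables (R : realType) (d m : nat).

(* Sym^2 R^d as the space of symmetric d x d matrices. *)
Definition Sym2 : {vspace 'M[R]_d} :=
  lker (linfun (fun M : 'M[R]_d => M^T - M)).

Lemma mem_Sym2 (M : 'M[R]_d) : (M \in Sym2) = (M^T == M).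
Proof.
have lin : linear (fun M : 'M[R]_d => M^T - M).
  by move=> a A B; rewrite linearP /= scalerBr opprD addrACA.
pose f := GRing.isLinear.Build _ _ _ _ _ lin.
pose g : {linear 'M[R]_d -> 'M[R]_d} := HB.pack (fun M : 'M[R]_d => M^T - M) f.
by rewrite memv_ker (lfunE g) /= subr_eq0.
Qed.

Lemma symprod_subproof (u v : 'rV[R]_d) :
  2^-1 *: (u^T *m v + v^T *m u) \in Sym2.
Proof.
by rewrite mem_Sym2 linearZ /= linearD /= !trmx_mul !trmxK addrC.
Qed.

(* Normalised so that the symmetric square of u is u^T *m u. *)
Definition symprod (u v : 'rV[R]_d) : subvs_of Sym2 :=
  Subvs (symprod_subproof u v).

Definition symmaps := 'Hom(subvs_of Sym2, 'rV[R]_m).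

Definition stdbasis (i : 'I_d) : 'rV[R]_d := delta_mx 0 i.

Definition dot (s t : 'rV[R]_m) : R := \sum_k s 0 k * t 0 k.

Definition pencil (A : symmaps) (t : 'rV[R]_m) : 'M[R]_d :=
  \matrix_(i, j) dot t (A (symprod (stdbasis i) (stdbasis j))).

(* s lists the eigenvalues of M, repeated according to multiplicity. *)
Definition eigenvalue_list (M : 'M[R]_d) (s : seq R) : Prop :=
  char_poly M = \prod_(x <- s) ('X - x%:P).

Definition two_eigenvalues_same_sign (M : 'M[R]_d) : Prop :=
  exists2 s, eigenvalue_list M s &
    (2 <= count (fun x : R => (0 < x)%R) s)%N \/
    (2 <= count (fun x : R => (x < 0)%R) s)%N.

Definition Uset : set (fdspace symmaps) :=
  [set A | forall t : 'rV[R]_m, t != 0 -> (2 <= \rank (pencil A t))%N].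

Definition Utilde : set (fdspace symmaps) :=
  [set A | forall t : 'rV[R]_m, t != 0 ->
    two_eigenvalues_same_sign (pencil A t)].

End SymmetricMaps.

Arguments symmaps R d m : clear implicits.
Arguments Uset R d m : clear implicits.
Arguments Utilde R d m : clear implicits.

(* Main.v *)
Require Import Defs.
From HB Require Import structures.
From mathcomp Require Import all_boot all_order all_algebra.
From mathcomp Require Import all_classical all_reals all_analysis.
From mathcomp Require Import -(notations) mpoly.
From mathcomp Require Import complex ring lra zify.
Set Implicit Arguments. Unset Strict Implicit. Unset Printing Implicit Defensive.
Import Order.TTheory GRing.Theory Num.Theory numFieldNormedType.Exports.
Local Open Scope classical_set_scope.
Local Open Scope ring_scope.

(** A map A is recorded by its pencil P(t) of symmetric matrices, and the pencil
    is an arbitrary linear map from R^m to symmetric d x d matrices.  By the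
    real spectral theorem and the 2 x 2 Cauchy-Binet formula, a symmetric P has
    rank at least 2 (resp. two nonzero eigenvalues of the same sign) iff
    det (X P X^T) is nonzero (resp. positive) for some 2 x d matrix X; the
    complementary cones are {v^T v, - v^T v} and {u^T v + v^T u}, of dimensions
    d and 2d - 1.  Openness follows from compactness of the unit sphere of t,
    and (i), (v) from solving linear equations that force P(t) into the bad cone.
    For (ii) the pencil takes values in the trace zero matrices, none of which
    has rank 1.  For (iii) and (vi) the pencil is chosen transverse to the cone
    at a common point, and such an intersection survives perturbation by
    Banach's fixed point theorem.  For (iv) and (vii) the bad maps are the
    images of finitely many polynomial maps with fewer than dim L parameters
    (normalise t_k = 1 and solve for the k-th matrix), so by counting monomials
    they lie in a hypersurface, whose complement is dense. *)

(** * Spectral theorem for real symmetric matrices *)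

Lemma row_norm_gt0 (R : realDomainType) n (w : 'rV[R]_n) :
  w != 0 -> 0 < (w *m w^T) 0 0.
Proof.
move=> /rV0Pn [j wj]; rewrite mxE (bigD1 j) //= mxE -expr2.
rewrite ltr_wpDr ?exprn_even_gt0 ?sumr_ge0 // => i _.
by rewrite mxE -expr2 sqr_ge0.
Qed.

Section RealSymmetricMatrices.
Variable R : rcfType.

(** The complexified matrix is hermitian, hence unitarily diagonalisable with real spectrum; a real
    eigenvalue over the complex field is already one over [R]. *)
Lemma symmetric_eigenvector n (M : 'M[R]_n.+1) : M^T = M ->
  exists (a : R) (v : 'rV_n.+1), v != 0 /\ v *m M = a *: v.
Proof.
move=> symM; pose MC : 'M[complex R]_n.+1 := map_mx (real_complex R) M.
have hermM : MC \is hermsymmx.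
  apply: realsym_hermsym; last by apply/mxOverP => i j; rewrite mxE complex_real.
  apply/is_hermitianmxP; rewrite expr0 scale1r map_mx_id //.
  by rewrite /MC map_trmx symM.
have /orthomx_spectralP := hermitian_normalmx hermM.
set P := spectralmx MC; set D := spectral_diag MC => decM.
have unitP : P \in unitmx by exact: spectral_unit.
have /mxOverP/(_ 0 0)/complex_realP [a Da] := hermitian_spectral_diag_real hermM.
have : eigenvalue MC (real_complex R a).
  apply/eigenvalueP; exists (row 0 P).
    by rewrite {1}decM -!row_mul !mulmxA mulmxV // mul1mx row_mul row_diag_mx
      Da -scalemxAl -rowE.
  apply/eqP => P0; have /(congr1 (mulmx^~ (invmx P))) := P0.
  rewrite rowE mul0mx mulmxK // => /matrixP /(_ 0 0) /eqP.
  by rewrite !mxE oner_eq0.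
rewrite eigenvalue_map => /eigenvalueP [v vM v0].
by exists a, v.
Qed.

(** Householder reflection: if [v] differs from the first basis vector [e], the reflection in the
    hyperplane orthogonal to v - e exchanges [v] and [e], so its first row is [v]. *)
Lemma unit_row_complete n (v : 'rV[R]_n.+1) : v *m v^T = 1%:M ->
  exists H : 'M[R]_n.+1, H *m H^T = 1%:M /\ row 0 H = v.
Proof.
move=> v1; pose e : 'rV[R]_n.+1 := delta_mx 0 0.
have [->|ve] := eqVneq v e.
  by exists 1%:M; split; [rewrite trmx1 mulmx1 | rewrite row1].
have [w wE] : exists w, w = v - e by exists (v - e).
pose s : R := (w *m w^T) 0 0.
have ww : w *m w^T = s%:M by rewrite [LHS]mx11_scalar.
have ev : e *m v^T = (v 0 0)%:M :> 'M[R]_1.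
  by rewrite -rowE [LHS]mx11_scalar !mxE.
have ve' : v *m e^T = (v 0 0)%:M by rewrite -[LHS]trmxK trmx_mul trmxK ev tr_scalar_mx.
have ee : e *m e^T = 1%:M.
  by rewrite [LHS]mx11_scalar trmx_delta mul_delta_mx mxE.
have sE : s = 2 * (1 - v 0 0).
  rewrite /s wE linearB /= mulmxBl !mulmxBr v1 ev ve' ee !mxE /=.
  ring.
have s0 : s != 0 by rewrite gt_eqF // row_norm_gt0 // wE subr_eq0.
pose H : 'M[R]_n.+1 := 1%:M - (2 / s) *: (w^T *m w).
have symH : H^T = H by rewrite /H linearB linearZ /= trmx1 trmx_mul trmxK.
exists H; split.
  rewrite symH /H mulmxBl mul1mx mulmxBr mulmx1 -scalemxAl -scalemxAr.
  rewrite mulmxA -(mulmxA _ w) ww mul_mx_scalar -scalemxAl !scalerA.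
  rewrite -addrA -opprD -scalerBl -scalerDl [X in X *: _](_ : _ = 0).
    by rewrite scale0r subr0.
  by field.
rewrite rowE -/e /H mulmxBr mulmx1 -scalemxAr mulmxA.
rewrite [in e *m _]wE linearB /= mulmxBr ev ee -raddfB /= mul_scalar_mx scalerA.
rewrite (_ : 2 / s * _ = -1) ?scaleN1r ?opprK ?wE ?subrKC //.
by apply: (mulIf s0); rewrite mulrAC divfK // sE; ring.
Qed.

(** Induction on the size: conjugating by an orthogonal [H] whose first row is a unit eigenvector
    splits off a 1 x 1 block. *)
Lemma symmetric_spectral n (M : 'M[R]_n) : M^T = M ->
  exists (O : 'M[R]_n) (D : 'rV_n), O *m O^T = 1%:M /\ M = O^T *m diag_mx D *m O.
Proof.
elim: n M => [|n IH] M symM.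
  by exists 0, 0; split; apply/matrixP => - [].
have [a [w [w0 wM]]] := symmetric_eigenvector symM.
pose s := (w *m w^T) 0 0.
have sw : w *m w^T = s%:M by rewrite [LHS]mx11_scalar.
have s0 : 0 < s by exact: row_norm_gt0.
pose v := (Num.sqrt s)^-1 *: w.
have vM : v *m M = a *: v by rewrite -scalemxAl wM scalerA mulrC -scalerA.
have [|H [HH Hv]] := @unit_row_complete _ v.
  rewrite /v linearZ /= -scalemxAl -scalemxAr sw scalerA -invfM -expr2.
  by rewrite sqr_sqrtr ?ltW // scale_scalar_mx mulVf // gt_eqF.
have HtH : H^T *m H = 1%:M by exact: mulmx1C.
have [K KH] : exists K : 'M[R]_(1 + n), K = H *m M *m H^T by exists (H *m M *m H^T).
have symK : K^T = K by rewrite KH !trmx_mul trmxK symM mulmxA.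
have row0K : row 0 K = a *: delta_mx 0 0.
  rewrite KH -mulmxA row_mul Hv mulmxA vM -scalemxAl -Hv -row_mul HH.
  by rewrite row1.
have K0 j : K 0 j = a * (j == 0)%:R.
  by have /rowP/(_ j) := row0K; rewrite !mxE eqxx eq_sym.
have KE : K = block_mx a%:M 0 0 (drsubmx K).
  rewrite -[LHS]submxK; congr block_mx; apply/matrixP => i j.
  - by rewrite !mxE !ord1 lshift0 K0 eqxx mulr1 ?mulr1n.
  - by rewrite !mxE !ord1 lshift0 K0 mulr0.
  - by rewrite -symK !mxE !ord1 lshift0 K0 mulr0.
have [|O [D [OO DE]]] := IH (drsubmx K).
  by rewrite trmx_drsub symK.
pose B : 'M[R]_(1 + n) := block_mx 1%:M 0 0 O.
pose E : 'rV[R]_(1 + n) := row_mx a%:M D.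
have BB : B *m B^T = 1%:M.
  rewrite tr_block_mx mulmx_block !trmx0 trmx1.
  by rewrite !(mulmx0, mul0mx, mulmx1, addr0, add0r) OO -scalar_mx_block.
have BK : B^T *m diag_mx E *m B = K.
  rewrite [RHS]KE tr_block_mx !trmx0 trmx1 diag_mx_row.
  rewrite !mulmx_block !(mulmx0, mul0mx, mulmx1, mul1mx, addr0, add0r).
  rewrite -DE; congr block_mx.
  by apply/matrixP => i j; rewrite !ord1 !mxE.
exists (B *m (H : 'M[R]_(1 + n))), E; split.
  by rewrite trmx_mul mulmxA -(mulmxA B) HH mulmx1.
rewrite trmx_mul mulmxA -2!(mulmxA H^T) BK KH.
by rewrite !mulmxA HtH mul1mx -mulmxA HtH mulmx1.
Qed.
End RealSymmetricMatrices.

(** * Signs of the 2 x 2 minors X M X^T *)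

Lemma det_mx22 (R : comNzRingType) (M : 'M[R]_2) :
  \det M = M 0 0 * M 1 1 - M 0 1 * M 1 0.
Proof.
rewrite (expand_det_row _ 0) !big_ord_recl big_ord0 /cofactor !det_mx11 !mxE.
rewrite /= addr0 expr0 expr1 mul1r mulN1r mulrN.
by congr (_ * M _ _ - M _ _ * M _ _); apply/val_inj.
Qed.

Section MinorSigns.
Variable R : realType.

(** Cauchy-Binet. The sum runs over ordered pairs and so counts every minor of [Y] twice, whence the
    factor 2. *)
Lemma det_congr_diag n (Y : 'M[R]_(2, n)) (D : 'rV_n) :
  \det (Y *m diag_mx D *m Y^T) *+ 2 =
  \sum_i \sum_j (D 0 i * D 0 j) * (Y 0 i * Y 1 j - Y 0 j * Y 1 i) ^+ 2.
Proof.
have YE a b : (Y *m diag_mx D *m Y^T) a b = \sum_i D 0 i * (Y a i * Y b i).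
  rewrite !mxE; apply: eq_bigr => i _; rewrite mul_mx_diag !mxE; ring.
have prodE (F G : 'I_n -> R) :
    (\sum_i F i) * (\sum_j G j) = \sum_i \sum_j F i * G j.
  by rewrite mulr_suml; apply: eq_bigr => i _; rewrite mulr_sumr.
rewrite mulr2n {1}det_mx22 addrC det_mx22 !YE [X in X - _ + _]mulrC !prodE.
rewrite addrACA -opprD -!big_split -sumrB; apply: eq_bigr => i _ /=.
by rewrite -!big_split -sumrB; apply: eq_bigr => j _ /=; ring.
Qed.

(** Rows i and j of [O] are orthonormal eigenvectors, so compressing [M] to them gives diag(D_i,
    D_j). *)
Lemma det_congr_rowsub n (M O : 'M[R]_n) (D : 'rV_n) i j :
  O *m O^T = 1%:M -> M = O^T *m diag_mx D *m O -> i != j ->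
  exists X : 'M[R]_(2, n), \det (X *m M *m X^T) = D 0 i * D 0 j.
Proof.
move=> OO -> /negPf ij; pose f (a : 'I_2) := if a == 0 then i else j.
exists (rowsub f O); rewrite (_ : _ *m _ *m _ = mxsub f f (diag_mx D)).
  by rewrite det_mx22 !mxE /= !eqxx ij !mulr1n mulr0n mul0r subr0.
rewrite trmx_mxsub !mul_rowsub_mx mulmx_colsub.
rewrite !mulmxA OO mul1mx -mulmxA OO mulmx1.
by apply/matrixP => a b; rewrite !mxE.
Qed.

Lemma char_poly_orth_diag n (M O : 'M[R]_n) (D : 'rV_n) :
  O *m O^T = 1%:M -> M = O^T *m diag_mx D *m O ->
  eigenvalue_list M [seq D 0 i | i <- enum 'I_n].
Proof.
move=> OO ->; rewrite /eigenvalue_list big_map big_enum /=.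
have OtO := mulmx1C OO.
rewrite /char_poly /char_poly_mx !map_mxM /=.
rewrite (_ : _ - _ = map_mx polyC O^T *m ('X%:M - map_mx polyC (diag_mx D))
   *m map_mx polyC O).
  rewrite !det_mulmx mulrC mulrA -det_mulmx -map_mxM OO map_mx1 det1 mul1r.
  rewrite -[RHS]big_enum -/(char_poly (diag_mx D)).
  rewrite char_poly_trig ?diag_mx_is_trig // big_enum /=.
  by apply: eq_bigr => i _; rewrite !mxE eqxx.
rewrite mulmxBr mulmxBl mul_mx_scalar -scalemxAl.
rewrite -[map_mx polyC O^T *m map_mx polyC O]map_mxM OtO map_mx1.
by rewrite scalemx1.
Qed.

Lemma orth_diag_sum n (O : 'M[R]_n) (D : 'rV_n) :
  O^T *m diag_mx D *m O = \sum_i D 0 i *: ((row i O)^T *m row i O).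
Proof.
apply/matrixP => a b; rewrite !mxE summxE; apply: eq_bigr => i _.
by rewrite mul_mx_diag !mxE big_ord1 !mxE mulrAC mulrC mulrCA mulrA.
Qed.

Lemma trmx_mul_scale n (a : R) (v : 'rV[R]_n) :
  (a *: v)^T *m (a *: v) = a ^+ 2 *: (v^T *m v).
Proof. by rewrite [(a *: v)^T]linearZ /= -scalemxAl -scalemxAr scalerA. Qed.

Lemma trmx_mul_sum_pred n (P : pred 'I_n) (f : 'I_n -> 'rV[R]_n) :
  (forall i j, P i -> P j -> i = j) ->
  (\sum_(i | P i) f i)^T *m (\sum_(i | P i) f i) =
  \sum_(i | P i) (f i)^T *m f i.
Proof.
move=> P1; have [k Pk|P0] := pickP P; last by rewrite !big_pred0 // mulmx0.
have PE : P =1 pred1 k.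
  by move=> i /=; apply/idP/eqP => [/P1|->//]; exact.
by rewrite !(big_pred1 k).
Qed.

(** Compression by [X] replaces u, v by plane vectors x, y, and the determinant becomes minus the
    square of x_0 y_1 - x_1 y_0. *)
Lemma det_symprod_le0 n (X : 'M[R]_(2, n)) (u v : 'rV_n) :
  \det (X *m (u^T *m v + v^T *m u) *m X^T) <= 0.
Proof.
have [x xE] : exists x, x = u *m X^T by exists (u *m X^T).
have [y yE] : exists y, y = v *m X^T by exists (v *m X^T).
rewrite (_ : _ *m _ = x^T *m y + y^T *m x); last first.
  by rewrite xE yE !trmx_mul trmxK mulmxDr mulmxDl !mulmxA.
rewrite det_mx22 !mxE !big_ord1 !mxE -oppr_ge0.
rewrite (_ : - _ = (x 0 0 * y 0 1 - x 0 1 * y 0 0) ^+ 2) ?sqr_ge0 //.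
ring.
Qed.

Section Symmetric.
Variables (n : nat) (M : 'M[R]_n).
Hypothesis symM : M^T = M.

(** Products of two eigenvalues at distinct positions are such determinants, hence zero, so at most
    one eigenvalue is nonzero; [b] records its sign. *)
Lemma minors_eq0_square : (forall X : 'M[R]_(2, n), \det (X *m M *m X^T) = 0) ->
  exists (b : bool) (v : 'rV_n), M = (-1) ^+ b *: (v^T *m v).
Proof.
move=> minor0; have [Q [D [QQ MD]]] := symmetric_spectral symM.
have DD i j : i != j -> D 0 i * D 0 j = 0.
  by move=> ij; have [X <-] := det_congr_rowsub QQ MD ij; exact: minor0.
have [k Dk|D0] := pickP (fun i => D 0 i != 0); last first.
  exists false, 0; rewrite mulmx0 scaler0 MD orth_diag_sum big1 // => i _.
  by have /negbFE/eqP -> := D0 i; rewrite scale0r.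
exists (D 0 k < 0), (Num.sqrt `|D 0 k| *: row k Q).
rewrite trmx_mul_scale scalerA sqr_sqrtr ?normr_ge0 // -realEsign ?num_real //.
rewrite MD orth_diag_sum (bigD1 k) //= big1 ?addr0 // => i ik.
by move/eqP: (DD _ _ ik); rewrite mulf_eq0 (negPf Dk) orbF => /eqP ->; rewrite scale0r.
Qed.

(** At most one eigenvalue is positive and at most one negative, so M = x^T x - y^T y, and this
    difference of squares is the symmetric product of (x - y)/2 and x + y. *)
Lemma minors_le0_symprod : (forall X : 'M[R]_(2, n), \det (X *m M *m X^T) <= 0) ->
  exists u v : 'rV_n, M = u^T *m v + v^T *m u.
Proof.
move=> minor0; have [Q [D [QQ MD]]] := symmetric_spectral symM.
have DD i j : i != j -> D 0 i * D 0 j <= 0.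
  by move=> ij; have [X <-] := det_congr_rowsub QQ MD ij; exact: minor0.
pose x := \sum_(i | 0 < D 0 i) Num.sqrt (D 0 i) *: row i Q.
pose y := \sum_(i | D 0 i < 0) Num.sqrt (- D 0 i) *: row i Q.
have ME : M = x^T *m x - y^T *m y.
  rewrite /x /y !trmx_mul_sum_pred; first last.
  - move=> i j Di Dj; apply/eqP; apply: contraT => /DD.
    by rewrite leNgt mulr_gt0.
  - move=> i j Di Dj; apply/eqP; apply: contraT => /DD.
    by rewrite leNgt nmulr_rgt0 // Dj.
  rewrite MD orth_diag_sum (bigID (fun i => 0 < D 0 i)) /=; congr (_ + _).
    apply: eq_bigr => i Di; by rewrite trmx_mul_scale sqr_sqrtr ?ltW.
  rewrite (bigID (fun i => D 0 i < 0)) /= [X in _ + X]big1 ?addr0; last first.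
    by move=> i; rewrite -!leNgt -eq_le => /eqP ->; rewrite scale0r.
  rewrite -sumrN; apply: eq_big => [i|i /andP [_ Di]].
    by case: ltrgt0P.
  by rewrite trmx_mul_scale sqr_sqrtr ?oppr_ge0 ?ltW // scaleNr opprK.
exists (2^-1 *: (x - y)), (x + y); rewrite ME.
rewrite [(2^-1 *: _)^T]linearZ /= -scalemxAr -scalemxAl -scalerDr.
apply: (@scalerI _ _ 2); rewrite ?pnatr_eq0 // scalerA divff ?pnatr_eq0 // scale1r.
rewrite scaler_nat mulr2n [(x + y)^T]linearD [(x - y)^T]linearB /=.
rewrite !mulmxDl !mulmxDr !mulNmx !mulmxN.
by apply/matrixP => i j; rewrite ![in LHS]mxE ![in RHS]mxE; ring.
Qed.

(** If all these determinants vanish, [M] is plus or minus a square, of rank at most 1; conversely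
    an invertible 2 x 2 compression forces rank at least 2. *)
Lemma rank_ge2P :
  (2 <= \rank M)%N <-> exists X : 'M[R]_(2, n), \det (X *m M *m X^T) != 0.
Proof.
split=> [rM|[X detX]].
  apply: contrapT => /forallNP noX.
  have [X|b [v ME]] := minors_eq0_square.
    by move/negP/negPn/eqP: (noX X).
  suff : (\rank M <= 1)%N by rewrite leqNgt rM.
  by rewrite ME (leq_trans (mxrankS (scalemx_sub _ (submxMl _ _)))) // rank_leq_row.
have /mxrank_unit <- : X *m M *m X^T \in unitmx by rewrite unitmxE unitfE.
exact: leq_trans (mxrankM_maxl _ _) (mxrankM_maxr _ _).
Qed.

(** Unique factorisation of the characteristic polynomial identifies any eigenvalue list with the
    diagonal [D] up to order. By Cauchy-Binet a positive determinant requires D_i D_j > 0 for some i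
    != j. *)
Lemma two_eigenvaluesP : two_eigenvalues_same_sign M <->
  exists X : 'M[R]_(2, n), 0 < \det (X *m M *m X^T).
Proof.
have [Q [D [QQ MD]]] := symmetric_spectral symM.
have charM := char_poly_orth_diag QQ MD.
have countE (p : pred R) : count p [seq D 0 i | i <- enum 'I_n] =
    #|[pred i | p (D 0 i)]|.
  by rewrite count_map -sum1_count -sum1_card big_enum_cond.
split=> [[s charMs]|[X detX]].
  have /prod_XsubC_eq perm_s : \prod_(x <- s) ('X - x%:P) =
      \prod_(x <- [seq D 0 i | i <- enum 'I_n]) ('X - x%:P).
    by rewrite -charMs -charM.
  have count_s p := seq.permP perm_s p.
  rewrite !count_s !countE => - [] /card_gt1P [i [j [Di Dj ij]]];
    have [X XE] := det_congr_rowsub QQ MD ij; exists X; rewrite XE.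
  - exact: mulr_gt0.
  - by rewrite nmulr_rgt0.
have [i [j [ij Dij]]] : exists i j, i != j /\ 0 < D 0 i * D 0 j.
  apply: contrapT => noij; move: detX; apply/negP; rewrite -leNgt.
  rewrite -(pmulrn_lle0 _ (ltn0Sn 1)).
  rewrite (_ : X *m M *m X^T =
    (X *m Q^T) *m diag_mx D *m (X *m Q^T)^T); last first.
    by rewrite trmx_mul trmxK MD !mulmxA.
  rewrite det_congr_diag sumr_le0 // => i _; rewrite sumr_le0 // => j _.
  have [->|ij] := eqVneq i j; first by rewrite subrr expr0n mulr0.
  rewrite mulr_le0_ge0 ?sqr_ge0 // leNgt; apply/negP => Dij.
  by apply: noij; exists i, j.
exists [seq D 0 i | i <- enum 'I_n] => //; rewrite !countE.
have [Di|Di|Di] := ltrgt0P (D 0 i); last by rewrite Di mul0r ltxx in Dij.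
  left; apply/card_gt1P; exists i, j; split => //.
  by rewrite inE -(pmulr_rgt0 _ Di).
right; apply/card_gt1P; exists i, j; split => //.
by rewrite inE -(nmulr_rgt0 _ Di).
Qed.

End Symmetric.
End MinorSigns.

(** * Openness of pencil conditions *)

Section MatrixTopology.
Variable R : realType.

Lemma mx_entry_le_norm m n (M : 'M[R]_(m, n)) i j : `|M i j| <= `|M|.
Proof.
rewrite [leRHS]/Num.Def.normr /= mx_normrE.
exact: (le_bigmax _ (fun ij => `|M ij.1 ij.2|) (i, j)).
Qed.

Lemma mx_norm_le m n (M : 'M[R]_(m, n)) (e : R) : 0 <= e ->
  (forall i j, `|M i j| <= e) -> `|M| <= e.
Proof.
move=> e0 Me; rewrite [leLHS]/Num.Def.normr /= mx_normrE.
by apply/bigmax_leP; split => // -[i j].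
Qed.

Section Convergence.
Variables (X : Type) (F : set_system X).
Context {FF : Filter F}.

Lemma cvg_mx m n (f : X -> 'M[R]_(m, n)) (a : 'M[R]_(m, n)) :
  (forall i j, f x i j @[x --> F] --> a i j) -> f @ F --> a.
Proof.
move=> fa A [P aP PA]; apply: filterS (_ : F (f @^-1` [set M | forall i j, P i j (M i j)])).
  by move=> x; exact: PA.
by apply: filter_forall => i; apply: filter_forall => j; exact: fa.
Qed.

Lemma cvg_mulmx m n p (f : X -> 'M[R]_(m, n)) (g : X -> 'M[R]_(n, p))
    (a : 'M[R]_(m, n)) (b : 'M[R]_(n, p)) :
  f @ F --> a -> g @ F --> b -> f x *m g x @[x --> F] --> a *m b.
Proof.
move=> fa gb; apply: cvg_mx => i j; rewrite mxE.
under eq_fun do rewrite mxE.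
apply: (@cvg_big _ _ _ _ _ (@add_continuous R)) => k _.
apply: cvgM.
- exact: (continuous_cvg _ (@coord_continuous R _ _ i k a) fa).
- exact: (continuous_cvg _ (@coord_continuous R _ _ k j b) gb).
Qed.
End Convergence.

Lemma cvg_det_congr n (X : 'M[R]_(2, n)) (M : 'M[R]_n) :
  \det (X *m N *m X^T) @[N --> M] --> \det (X *m M *m X^T).
Proof.
have cvgX : X *m N *m X^T @[N --> M] --> X *m M *m X^T.
  apply: (@cvg_mulmx _ (nbhs M)); last exact: cvg_cst.
  by apply: (@cvg_mulmx _ (nbhs M)); [exact: cvg_cst|exact: cvg_id].
rewrite det_mx22; under eq_fun do rewrite det_mx22.
have cvgij i j : (X *m N *m X^T) i j @[N --> M] --> (X *m M *m X^T) i j.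
  exact: (continuous_cvg _ (@coord_continuous R _ _ i j _) cvgX).
exact: (cvgB (cvgM (cvgij 0 0) (cvgij 1 1)) (cvgM (cvgij 0 1) (cvgij 1 0))).
Qed.

Lemma open_exists_det_congr n (A : set R) : open A ->
  open [set M : 'M[R]_n | exists X : 'M[R]_(2, n), A (\det (X *m M *m X^T))].
Proof.
move=> oA; rewrite openE => M [X AX].
apply: (@filterS _ (nbhs M) _ [set N | A (\det (X *m N *m X^T))]).
  by move=> N ?; exists X.
by apply: cvg_det_congr; exact: open_nbhs_nbhs.
Qed.

Section FiniteDimensional.
Variables (V : vectType R) (m n : nat) (f : {linear V -> 'M[R]_(m, n)}).

Lemma linear_fdspace_continuous : continuous (f : fdspace V -> 'M[R]_(m, n)).
Proof.
pose g (x : 'rV[R]_(\dim {:V})) : 'M[R]_(m, n) :=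
  \sum_i x 0 i *: f (vbasis {:V})`_i.
have -> : (f : V -> 'M[R]_(m, n)) = g \o @coords R V.
  apply/funext => v /=; rewrite /g {1}(coord_vbasis (memvf v)).
  by rewrite linear_sum; apply: eq_bigr => i _; rewrite linearZ mxE.
have cg : continuous g.
  apply: (@continuous_big _ _ _ _ _ (@add_continuous 'M[R]_(m, n))) => k _ x.
  exact: (cvgZ (@coord_continuous R _ _ 0 k x) (cvg_cst _)).
move=> v; apply: (@continuous_comp (fdspace V) _ _ (@coords R V) g).
  exact: initial_continuous.
exact: cg.
Qed.
End FiniteDimensional.

End MatrixTopology.

Section Pencil.
Variables (R : realType) (d m : nat).
Implicit Types (A : symmaps R d m) (t : 'rV[R]_m).

(** Row k is the flattened matrix of the k-th component of [A], so the pencil at t is the product of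
    t with this matrix. *)
Definition pencil_mx A : 'M[R]_(m, d * d) :=
  \matrix_k mxvec (\matrix_(i, j) A (symprod (stdbasis R i) (stdbasis R j)) 0 k).

Lemma pencil_mxE A t : pencil A t = vec_mx (t *m pencil_mx A).
Proof.
apply/matrixP => i j; rewrite !mxE; apply: eq_bigr => k _.
by rewrite !mxE mxvecE mxE.
Qed.

Fact pencil_mx_linear : linear pencil_mx.
Proof.
move=> a A B; apply/row_matrixP => k; rewrite linearP /= !rowK -linearP /=.
congr mxvec; apply/matrixP => i j; rewrite !mxE.
by rewrite add_lfunE scale_lfunE !mxE.
Qed.
HB.instance Definition _ := GRing.isLinear.Build R (symmaps R d m)
  'M[R]_(m, d * d) _ pencil_mx pencil_mx_linear.

Lemma symprodC (u v : 'rV[R]_d) : symprod u v = symprod v u.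
Proof. by apply/val_inj; rewrite /= addrC. Qed.

Lemma tr_pencil A t : (pencil A t)^T = pencil A t.
Proof. by apply/matrixP => i j; rewrite !mxE symprodC. Qed.

(* The tube lemma on the unit sphere of [t]s. *)
Lemma open_forall_pencil (G : set 'M[R]_d) : open G ->
  (forall c M, c != 0 -> G M -> G (c *: M)) ->
  open [set A : fdspace (symmaps R d m) | forall t, t != 0 -> G (pencil A t)].
Proof.
move=> oG coneG; rewrite openE => A GA.
pose K := [set t : 'rV[R]_m | `|t| = 1].
have cK : compact K.
  apply: bounded_closed_compact.
    by exists 1; split => // x x1 t /= ->; exact: ltW.
  rewrite (_ : K = Num.norm @^-1` [set (1 : R)]) //.
  apply: preimage_closed; last exact: closed_eq.
  by move=> t _; exact: norm_continuous.
have := compact_near_coveringP K => - [/(_ cK) /(_ _ (nbhs A) (fun B t => G (pencil B t)) _) + _].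
have near_t t : K t -> \near t & A, G (pencil A t).
  move=> Kt; have t0 : t != 0.
    by apply: contra_eq_neq Kt => ->; rewrite normr0 eq_sym oner_eq0.
  have /= cvgA : pencil_mx B @[B --> A] --> pencil_mx A.
    exact: linear_fdspace_continuous.
  have : pencil x.2 x.1 @[x --> (t, A)] --> pencil A t.
    rewrite pencil_mxE; under eq_fun do rewrite pencil_mxE.
    have cvgM : x.1 *m pencil_mx x.2 @[x --> (t, A)]
        --> t *m pencil_mx A.
      apply: cvg_mulmx.
        exact: cvg_fst.
      move=> P /cvgA AP; exists (setT, pencil_mx @^-1` P).
        by split => //; exact: filterT.
      by move=> [x B] [_ ?].
    apply: cvg_mx => i j; rewrite mxE; under eq_fun do rewrite mxE.
    exact: (continuous_cvg _ (@coord_continuous R _ _ 0 (mxvec_index i j) _) cvgM).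
  by move=> cvgP; apply: (cvgP G); apply: open_nbhs_nbhs; split => //; exact: GA.
move=> /(_ near_t); apply: filterS => B GB t t0.
have nt : `|t| != 0 by rewrite normr_eq0.
(* [G] is stable under nonzero scalars, so the unit sphere suffices. *)
rewrite (_ : pencil B t = `|t| *: pencil B (`|t|^-1 *: t)).
  apply: coneG => //; apply: GB; rewrite /K /= normrZ normfV normr_id.
  by rewrite mulVf.
by rewrite !pencil_mxE -scalemxAl linearZ /= scalerA divff // scale1r.
Qed.
End Pencil.

(** * Perturbation of a transverse solution *)

Section Perturbation.
Variable R : realType.

HB.instance Definition _ (m n : nat) := Complete.on 'M[R]_(m, n).

Lemma contraction_fixed_point m n (F : 'M[R]_(m, n) -> 'M[R]_(m, n)) (r q : R) :
  0 <= r -> 0 <= q < 1 ->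
  (forall y, `|y| <= r -> `|F y| <= r) ->
  (forall x y, `|x| <= r -> `|y| <= r -> `|F x - F y| <= q * `|x - y|) ->
  exists2 y, `|y| <= r & y = F y.
Proof.
move=> r0 /andP [q0 q1] Fr Fq; pose U := [set y : 'M[R]_(m, n) | `|y| <= r].
have FU : isFun _ _ U U F by split.
pose f : {fun U >-> U} := HB.pack F FU.
have ctr : is_contraction f.
  by exists (NngNum q0); split => //= -[x y] [/= Ux Uy]; exact: Fq.
have clU : closed U.
  rewrite (_ : U = Num.norm @^-1` [set z : R | z <= r]) //.
  apply: preimage_closed; last exact: closed_le.
  by move=> y _; exact: norm_continuous.
have neU : U !=set0 by exists 0; rewrite /U /= normr0.
by have [y] := banach_fixed_point ctr clU neU; exists y.
Qed.

Lemma mx_norm_mulmx m n p (A : 'M[R]_(m, n)) (B : 'M[R]_(n, p)) :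
  `|A *m B| <= n%:R * (`|A| * `|B|).
Proof.
apply: mx_norm_le => [|i j]; first by rewrite !mulr_ge0.
rewrite mxE (le_trans (ler_norm_sum _ _ _)) //.
rewrite [leRHS]mulr_natl -[X in _ *+ X](card_ord n) -sumr_const ler_sum // => k _.
by rewrite normrM ler_pM // mx_entry_le_norm.
Qed.

Lemma mx_norm_vec_mx m n (v : 'rV[R]_(m * n)) : `|vec_mx v| <= `|v|.
Proof. by apply: mx_norm_le => // i j; rewrite mxE mx_entry_le_norm. Qed.

(** Unlike [symprod], without the factor 1/2: the product of v with itself is 2 v^T v. *)
Definition mxsymprod d (u v : 'rV[R]_d) : 'M[R]_d := u^T *m v + v^T *m u.

Lemma mx_norm_symprod d (u v : 'rV[R]_d) : `|mxsymprod u v| <= 2 * (`|u| * `|v|).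
Proof.
apply: mx_norm_le => [|i j]; first by rewrite !mulr_ge0.
rewrite !mxE !big_ord1 !mxE (le_trans (ler_normD _ _)) //.
rewrite mulr_natl mulr2n !normrM lerD //; first by rewrite ler_pM // mx_entry_le_norm.
by rewrite mulrC ler_pM // mx_entry_le_norm.
Qed.

Lemma mxsymprodDl d (u u' v : 'rV[R]_d) :
  mxsymprod (u + u') v = mxsymprod u v + mxsymprod u' v.
Proof. by rewrite /mxsymprod linearD /= mulmxDl mulmxDr addrACA. Qed.

Lemma mxsymprodC d (u v : 'rV[R]_d) : mxsymprod u v = mxsymprod v u.
Proof. by rewrite /mxsymprod addrC. Qed.

Lemma mxsymprodDr d (u v v' : 'rV[R]_d) :
  mxsymprod u (v + v') = mxsymprod u v + mxsymprod u v'.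
Proof. by rewrite mxsymprodC mxsymprodDl !(mxsymprodC _ u). Qed.

Lemma mxsymprodNl d (u v : 'rV[R]_d) : mxsymprod (- u) v = - mxsymprod u v.
Proof. by rewrite /mxsymprod linearN /= mulNmx mulmxN opprD. Qed.

Lemma mxsymprodBB d (u v u' v' : 'rV[R]_d) :
  mxsymprod u v - mxsymprod u' v' = mxsymprod (u - u') v + mxsymprod u' (v - v').
Proof.
by rewrite mxsymprodDl mxsymprodDr mxsymprodNl (mxsymprodC u' (- v')) mxsymprodNl
  (mxsymprodC v') addrA addrNK.
Qed.

Lemma tr_mxsymprod d (u v : 'rV[R]_d) : (mxsymprod u v)^T = mxsymprod u v.
Proof. by rewrite /mxsymprod linearD /= !trmx_mul !trmxK addrC. Qed.

(* The equation [vec_mx (t *m P) = u . v] is solved for [P] close to [B] by a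
   fixed point [y] of the map [F] below; the hypothesis on [T], [u], [v] says
   that the linearisation of the equation at the solution [(t0, u0, v0)] for
   [P = B] has a right inverse [y |-> (T y, u y, v y)]. *)
Lemma symprod_perturbation d m (B : 'M[R]_(m, d * d)) (t0 : 'rV[R]_m)
    (u0 v0 : 'rV[R]_d) (T : {additive 'M[R]_d -> 'rV[R]_m})
    (u v : {additive 'M[R]_d -> 'rV[R]_d}) :
  (forall y, `|T y| <= `|y|) -> (forall y, `|u y| <= `|y|) ->
  (forall y, `|v y| <= `|y|) -> t0 != 0 ->
  vec_mx (t0 *m B) = mxsymprod u0 v0 ->
  (forall y, y^T = y ->
    vec_mx (T y *m B) = y + mxsymprod u0 (v y) + mxsymprod (u y) v0) ->
  exists2 e : R, 0 < e & forall P : 'M[R]_(m, d * d), `|P - B| < e ->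
    (forall t, (vec_mx (t *m P))^T = vec_mx (t *m P)) ->
    (forall t, (vec_mx (t *m B))^T = vec_mx (t *m B)) ->
    exists y t, t != 0 /\ vec_mx (t *m P) = mxsymprod (u0 + u y) (v0 + v y).
Proof.
move=> Tle ule vle t0n eq0 eq1.
have nt0 : 0 < `|t0| by rewrite normr_gt0.
(* The bound 1/16 makes the quadratic term of [F] at most r/2 and its Lipschitz constant at most
   9r/2 < 1/2; the bound |t0|/2 keeps t0 + T y nonzero. *)
pose r : R := Num.min (16%:R^-1) (`|t0| / 2).
have r0 : 0 < r by rewrite lt_min invr_gt0 ltr0n divr_gt0.
have r16 : r <= 16%:R^-1 by rewrite ge_min lexx.
have rt0 : r <= `|t0| / 2 by rewrite ge_min lexx orbT.
(* Chosen so that closeness within r/(2c) bounds both m|Q| and m|Q|(|t0| + 1) by r/2. *)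
pose c : R := m%:R * (`|t0| + 1) + 1.
have c0 : 0 < c by rewrite ltr_wpDl // mulr_ge0 // addr_ge0.
exists (r / 2 / c); first by rewrite !divr_gt0.
move=> P PB symP symB; have [Q QP] : exists Q, Q = P - B by exists (P - B).
rewrite -QP in PB.
have QE : c * `|Q| <= r / 2 by rewrite mulrC -ler_pdivlMr // ltW.
have mQ0 : 0 <= m%:R * `|Q| by rewrite mulr_ge0.
have mQ : m%:R * `|Q| <= r / 2.
  apply: le_trans QE; rewrite ler_wpM2r // /c mulrDr mulr1.
  have : 0 <= m%:R * `|t0| by rewrite mulr_ge0.
  lra.
have mtQ : m%:R * `|Q| * (`|t0| + 1) <= r / 2.
  by apply: le_trans QE; rewrite mulrAC ler_wpM2r // lerDl.
(* In the equation at t0 + T y, u0 + u y, v0 + v y with P = B + Q, the constant and linear terms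
   cancel except [y] itself, leaving y = F y. *)
pose F y := mxsymprod (u y) (v y) - vec_mx ((t0 + T y) *m Q).
have tQ t : `|vec_mx (t *m Q)| <= m%:R * `|Q| * `|t|.
  by rewrite (le_trans (mx_norm_vec_mx _)) // (le_trans (mx_norm_mulmx _ _)) //
    -mulrA (mulrC `|Q|).
have [|||y yr yF] := @contraction_fixed_point _ _ F r (2^-1) (ltW r0).
- by lra.
- move=> y yr; rewrite (le_trans (ler_normB _ _)) //.
  have h1 : `|mxsymprod (u y) (v y)| <= r / 2.
    rewrite (le_trans (mx_norm_symprod _ _)) //.
    have : `|u y| * `|v y| <= r * r.
      by rewrite ler_pM // (le_trans (ule _), le_trans (vle _)).
    have : r * r <= r / 16 by rewrite ler_wpM2l // ltW.
    lra.
  have h2 : `|vec_mx ((t0 + T y) *m Q)| <= r / 2.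
    apply: le_trans mtQ; rewrite (le_trans (tQ _)) // ler_wpM2l //.
    rewrite (le_trans (ler_normD _ _)) // lerD2l (le_trans (Tle _)) //.
    rewrite (le_trans yr) // (le_trans r16) //; lra.
  lra.
- move=> x y xr yr.
  have -> : F x - F y = mxsymprod (u (x - y)) (v x) + mxsymprod (u y) (v (x - y))
      - vec_mx (T (x - y) *m Q).
    rewrite [T (_ - _)]raddfB [u (_ - _)]raddfB [v (_ - _)]raddfB -mxsymprodBB
      (_ : T x - T y = (t0 + T x) - (t0 + T y)).
      rewrite mulmxBl [vec_mx (_ - _)]raddfB /F /=.
      by rewrite !opprB [LHS]addrACA [RHS]addrACA [- _ - _ in RHS]addrC.
    by rewrite opprD addrACA subrr add0r.
  have nxy := normr_ge0 (x - y).
  have h1 : `|mxsymprod (u (x - y)) (v x)| <= 2 * (`|x - y| * r).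
    by rewrite (le_trans (mx_norm_symprod _ _)) // ler_wpM2l // ler_pM //
      (le_trans (vle _)).
  have h2 : `|mxsymprod (u y) (v (x - y))| <= 2 * (r * `|x - y|).
    by rewrite (le_trans (mx_norm_symprod _ _)) // ler_wpM2l // ler_pM //
      (le_trans (ule _)).
  have h3 : `|vec_mx (T (x - y) *m Q)| <= r / 2 * `|x - y|.
    by rewrite (le_trans (tQ _)) // ler_pM.
  rewrite (le_trans (ler_normB _ _)) // (le_trans (lerD (ler_normD _ _) h3)) //.
  have : r * `|x - y| <= 16%:R^-1 * `|x - y| by rewrite ler_wpM2r.
  nra.
exists y, (t0 + T y); split.
  rewrite addr_eq0; apply: contraTneq rt0 => t0E.
  have : `|t0| <= r by rewrite t0E normrN (le_trans (Tle _)).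
  lra.
(* The linearised identity is assumed for symmetric [y] only; symmetry of the fixed point follows
   from y = F y. *)
have symQ t : (vec_mx (t *m Q))^T = vec_mx (t *m Q).
  by rewrite QP mulmxBr !linearB /= symP symB.
have symy : y^T = y by rewrite yF /F linearB /= tr_mxsymprod symQ.
rewrite (_ : P = B + Q); last by rewrite QP addrC subrK.
rewrite mulmxDr mulmxDl !linearD /= eq0 eq1 //.
have : y + vec_mx ((t0 + T y) *m Q) = mxsymprod (u y) (v y).
  by rewrite {1}yF subrK.
rewrite mxsymprodDl !mxsymprodDr => <-.
have AC5 (a b s e f : 'M[R]_d) : a + (b + s + e) + f = a + s + (e + (b + f)).
  by rewrite !addrA (ACl (1*3*4*2*5)).
exact: AC5.
Qed.
End Perturbation.

(** * Maps with a prescribed pencil *)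

Section SymmapOfMatrix.
Variables (R : realType) (d m : nat).
Implicit Types (A : symmaps R d m) (B : 'M[R]_(m, d * d)).

(** The k-th coordinate of the image of S is the entrywise inner product of S with the k-th matrix
    of [B]. For symmetric rows this inverts [pencil_mx]. *)
Definition symmap_of B : symmaps R d m :=
  linfun (mulmxr B^T \o (mxvec \o (@vsval R _ (Sym2 R d)))).

Lemma symmap_ofE B S : symmap_of B S = mxvec (vsval S) *m B^T.
Proof. by rewrite lfunE. Qed.

Fact symmap_of_linear : linear symmap_of.
Proof.
move=> a B C; apply/lfunP => S.
by rewrite add_lfunE scale_lfunE !symmap_ofE linearP /= mulmxDr scalemxAr.
Qed.
HB.instance Definition _ := GRing.isLinear.Build R 'M[R]_(m, d * d)
  (symmaps R d m) _ symmap_of symmap_of_linear.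

Definition symmetric_rows B := forall k, (vec_mx (row k B))^T = vec_mx (row k B).

Lemma symmetric_rows_pencil_mx A : symmetric_rows (pencil_mx A).
Proof.
move=> k; rewrite rowK mxvecK; apply/matrixP => i j.
by rewrite !mxE symprodC.
Qed.

Lemma tr_vec_mul_symmetric_rows B t : symmetric_rows B ->
  (vec_mx (t *m B))^T = vec_mx (t *m B).
Proof.
move=> symB; rewrite -[t *m B]/(mulmx t B) mulmx_sum_row !linear_sum /=.
by apply: eq_bigr => k _; rewrite !linearZ /= symB.
Qed.

Lemma mul_trmx_row (v : 'rV[R]_(d * d)) B k :
  (v *m B^T) 0 k = (v *m (row k B)^T) 0 0.
Proof. by rewrite !mxE; apply: eq_bigr => q _; rewrite !mxE. Qed.

Lemma val_symprod_stdbasis i j :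
  vsval (symprod (stdbasis R i) (stdbasis R j : 'rV[R]_d)) =
  2^-1 *: (delta_mx i j + delta_mx j i).
Proof. by rewrite /= /stdbasis !trmx_delta !mul_delta_mx. Qed.

Lemma mxvec_dot (M : 'M[R]_d) (v : 'rV[R]_(d * d)) :
  (mxvec M *m v^T) 0 0 = \sum_i \sum_j M i j * (vec_mx v : 'M[R]_d) i j.
Proof.
rewrite mxE (reindex _ (curry_mxvec_bij _ _)) /= pair_bigA /=.
by apply: eq_bigr => -[i j] _; rewrite /= mxvecE !mxE.
Qed.

Lemma mxvec_dot_delta i j (v : 'rV[R]_(d * d)) :
  (mxvec (delta_mx i j : 'M[R]_d) *m v^T) 0 0 = (vec_mx v : 'M[R]_d) i j.
Proof.
rewrite mxvec_dot (bigD1 i) //= (bigD1 j) //= !mxE !eqxx mul1r.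
rewrite big1 => [|b bj]; last by rewrite mxE (negPf bj) andbF mul0r.
rewrite big1 => [|a ai]; first by rewrite !addr0.
by rewrite big1 // => b _; rewrite mxE (negPf ai) mul0r.
Qed.

Lemma symmap_ofK B : symmetric_rows B -> pencil_mx (symmap_of B) = B.
Proof.
move=> symB; apply/row_matrixP => k; rewrite rowK; apply: (can_inj vec_mxK).
rewrite mxvecK; apply/matrixP => i j; rewrite mxE symmap_ofE val_symprod_stdbasis.
rewrite mul_trmx_row linearZ linearD /= -scalemxAl mulmxDl mxE mxE.
rewrite !mxvec_dot_delta.
have -> : vec_mx (row k B) j i = vec_mx (row k B) i j by rewrite -[in LHS]symB mxE.
by field.
Qed.

(** A symmetric S is the sum of the S_ij e_i e_j, so these products span and a map is determined by
    its pencil. *)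
Lemma pencil_mxK A : symmap_of (pencil_mx A) = A.
Proof.
apply/lfunP => S; rewrite symmap_ofE; apply/rowP => k.
rewrite mul_trmx_row mxvec_dot rowK mxvecK.
have {2}-> : S = \sum_i \sum_j vsval S i j *: symprod (stdbasis R i) (stdbasis R j).
  apply/val_inj; have /eqP symS : (vsval S)^T == vsval S by rewrite -mem_Sym2 subvsP.
  rewrite [RHS]linear_sum.
  under eq_bigr => i _.
    rewrite linear_sum.
    under eq_bigr => j _ do rewrite linearZ /= /stdbasis
      !trmx_delta !mul_delta_mx scalerA mulrC -scalerA scalerDr.
    rewrite -scaler_sumr big_split /=.
  over.
  rewrite -scaler_sumr big_split /= -matrix_sum_delta.
  rewrite exchange_big /=.
  have -> : \sum_i \sum_j vsval S j i *: delta_mx i j = vsval S.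
    rewrite [RHS]matrix_sum_delta; apply: eq_bigr => i _; apply: eq_bigr => j _.
    by rewrite -[in LHS]symS mxE.
  by rewrite scalerDr -scalerDl (_ : 2^-1 + 2^-1 = 1 :> R) ?scale1r //; field.
rewrite linear_sum summxE; apply: eq_bigr => i _.
rewrite linear_sum summxE; apply: eq_bigr => j _.
by rewrite linearZ !mxE.
Qed.

End SymmapOfMatrix.

(** Positions on or above the diagonal in the lower right block of size d - a, that is, the
    independent entries of a symmetric matrix there. *)
Definition pairs_from (a d : nat) : {set 'I_d * 'I_d} :=
  [set p : 'I_d * 'I_d | (a <= p.1)%N && (p.1 <= p.2)%N].

(** Column j holds j + 1 - a positions (truncated subtraction); these counts add up by Pascal's
    rule. *)
Lemma card_pairs_from a d : #|pairs_from a d| = 'C((d - a).+1, 2).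
Proof.
have -> : #|pairs_from a d| = (\sum_(j < d) (j.+1 - a))%N.
  rewrite -sum1_card (eq_bigl (fun p : 'I_d * 'I_d => (a <= p.1)%N && (p.1 <= p.2)%N));
    last by move=> p; rewrite inE.
  rewrite -(pair_big_dep xpredT (fun i j : 'I_d => (a <= i)%N && (i <= j)%N)
    (fun _ _ => 1%N)) /= (exchange_big_dep xpredT) //=.
  apply: eq_bigr => j _; rewrite -(big_mkord (fun i => (a <= i)%N && (i <= j)%N) (fun=> 1%N)).
  rewrite -[RHS]muln1 -sum_nat_const_nat (big_nat_widenl a 0) // (big_nat_widen 0 j.+1 d) //.
elim: d => [|d IH]; first by rewrite big_ord0 sub0n.
rewrite big_ord_recr /= IH; case: (leqP a d) => ad.
  by rewrite subSn // [RHS]binS bin1.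
have -> : (d.+1 - a = 0)%N by apply/eqP; rewrite subn_eq0.
by have -> : (d - a = 0)%N by apply/eqP; rewrite subn_eq0 ltnW.
Qed.

(** * Vanishing entries, base pencils, and the two sets in terms of 2 x 2 determinants *)

Section Pencils.
Variables (R : realType) (d m : nat).
Implicit Types (A : symmaps R d m) (t : 'rV[R]_m).

(** Fewer linear equations than unknowns t_k. *)
Lemma pencil_vanish A (J : {set 'I_d * 'I_d}) : (#|J| < m)%N ->
  exists t, t != 0 /\ forall p, p \in J -> pencil A t p.1 p.2 = 0.
Proof.
move=> Jm; pose idx (q : 'I_#|J|) := mxvec_index (enum_val q).1 (enum_val q).2.
pose C := colsub idx (pencil_mx A).
have : kermx C != 0.
  by rewrite kermx_eq0 /row_free neq_ltn (leq_ltn_trans (rank_leq_col _)).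
move=> /rowV0Pn [t tC t0]; exists t; split => // p pJ.
have /sub_kermxP := tC; rewrite mulmx_colsub => /rowP/(_ (enum_rank_in pJ p)) tp.
by rewrite [LHS]mxE /idx enum_rankK_in // [RHS]mxE in tp; rewrite pencil_mxE [LHS]mxE.
Qed.

Definition symunit (p : 'I_d * 'I_d) : 'M[R]_d :=
  \matrix_(i, j) (((i, j) == p) || ((j, i) == p))%:R.

Lemma rank_scaled_square (a : R) (v : 'rV[R]_d) : (\rank (a *: (v^T *m v)) <= 1)%N.
Proof.
by rewrite (leq_trans (mxrankS (scalemx_sub _ (submxMl _ _)))) // rank_leq_row.
Qed.

(** By continuity of [pencil_mx], the maps with pencil within [e] of [B] form an open set, nonempty
    since it contains [symmap_of B]. *)
Lemma not_dense_near (W : set (fdspace (symmaps R d m))) (B : 'M[R]_(m, d * d)) (e : R) :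
  0 < e -> symmetric_rows B ->
  (forall A, `|pencil_mx A - B| < e -> ~ W A) -> ~ dense W.
Proof.
move=> e0 symB WB dW.
pose U := [set C : 'M[R]_(m, d * d) | `|B - C| < e].
have oU : open U.
  rewrite (_ : U = ball B e); first exact: ball_open.
  by rewrite mx_norm_ball.
have /(_ R _ _ _ (@pencil_mx R d m)) cont := linear_fdspace_continuous.
have [||A [UA WA]] := dW ((@pencil_mx R d m : fdspace _ -> _) @^-1` U).
- exists (symmap_of B); rewrite /U /= symmap_ofK // subrr normr0 //.
- by move/continuousP: cont; exact.
by apply: (WB A) => //; rewrite distrC.
Qed.

Section Base.
Variables (J : {set 'I_d * 'I_d}) (p0 : 'I_d * 'I_d).
Hypotheses (Jm : (#|J| <= m)%N) (Jp0 : p0 \in J) (Jle : J \subset pairs_from 0 d).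

Let nthJ (k : nat) := nth p0 (enum J) k.

(** Its pencil ranges over the symmetric matrices supported on [J] and its transpose; rows beyond
    #|J| are padded with 0. *)
Definition base_mx : 'M[R]_(m, d * d) :=
  \matrix_k (if (k < #|J|)%N then mxvec (symunit (nthJ k)) else 0).

Definition base_coord (y : 'M[R]_d) : 'rV[R]_m :=
  \row_k (if (k < #|J|)%N then y (nthJ k).1 (nthJ k).2 else 0).

Fact base_coord_additive : additive base_coord.
Proof.
move=> x y; apply/rowP => k; rewrite !mxE; case: ifP; rewrite ?mxE ?subr0 //.
Qed.

Lemma base_coord_le y : `|base_coord y| <= `|y|.
Proof.
apply: mx_norm_le => // i k; rewrite mxE; case: ifP => _; last by rewrite normr0.
exact: mx_entry_le_norm.
Qed.

Lemma symmetric_rows_base : symmetric_rows base_mx.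
Proof.
move=> k; rewrite rowK; case: ifP; last by rewrite !linear0.
by rewrite mxvecK => _; apply/matrixP => i j; rewrite !mxE orbC.
Qed.

(** No entry is counted twice because [J] lies on or above the diagonal: (a, b) and (b, a) are both
    in [J] only if a = b. *)
Lemma base_coordK y : y^T = y ->
  vec_mx (base_coord y *m base_mx) =
  \matrix_(i, j) (if ((i, j) \in J) || ((j, i) \in J) then y i j else 0).
Proof.
move=> symy; have sumE : vec_mx (base_coord y *m base_mx) =
    \sum_(p in J) y p.1 p.2 *: symunit p.
  rewrite mulmx_sum_row linear_sum /=.
  transitivity (\sum_(k < m | (k < #|J|)%N) y (nthJ k).1 (nthJ k).2 *: symunit (nthJ k)).
    rewrite [RHS]big_mkcond /=; apply: eq_bigr => k _.
    by rewrite linearZ /= rowK mxE; case: ifP; rewrite ?mxvecK // scale0r.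
  rewrite -(big_ord_widen _ (fun k => y (nthJ k).1 (nthJ k).2 *: symunit (nthJ k)) Jm).
  by rewrite -[RHS]big_enum /= (big_nth p0) -cardE big_mkord.
apply/matrixP => i j; rewrite sumE summxE mxE.
have anti a b : (a, b) \in J -> (b, a) \in J -> a = b.
  move=> /(fintype.subsetP Jle) + /(fintype.subsetP Jle); rewrite !inE /= => ab ba.
  by apply/val_inj/eqP; rewrite eqn_leq ab ba.
have entry p : (y p.1 p.2 *: symunit p) i j =
    y p.1 p.2 * (((i, j) == p) || ((j, i) == p))%:R by rewrite !mxE.
have yji : y j i = y i j by rewrite -[in LHS]symy mxE.
have [ij|nij] /= := boolP ((i, j) \in J).
  rewrite (bigD1 (i, j)) // entry /= eqxx mulr1 big1 ?addr0 // => p /andP [pJ pij].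
  rewrite entry eq_sym (negPf pij) /=; case: eqVneq => [pE|_]; last by rewrite mulr0.
  by move: pJ pij; rewrite -pE => ji; rewrite (anti _ _ ij ji) eqxx.
have [ji|nji] := boolP ((j, i) \in J).
  rewrite (bigD1 (j, i)) // entry /= eqxx orbT mulr1 yji.
  rewrite big1 ?addr0 // => p /andP [pJ pji]; rewrite entry orbC eq_sym (negPf pji) /=.
  by case: eqVneq => [pE|_]; [rewrite pE pJ in nij|rewrite mulr0].
rewrite big1 // => p pJ; rewrite entry.
case: eqVneq => [pE|_]; first by rewrite pE pJ in nij.
by case: eqVneq => [pE|_]; [rewrite pE pJ in nji|rewrite mulr0].
Qed.

HB.instance Definition _ := GRing.isZmodMorphism.Build 'M[R]_d 'rV[R]_m
  base_coord base_coord_additive.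

(* The right inverse required by [symprod_perturbation], with the coordinates
   in [J] carried by the pencil and all the others by [u] and [v]. *)
Lemma base_perturbation (u0 v0 : 'rV[R]_d) (u v : {additive 'M[R]_d -> 'rV[R]_d}) :
  (forall y, `|u y| <= `|y|) -> (forall y, `|v y| <= `|y|) ->
  mxsymprod u0 v0 = symunit p0 ->
  (forall y, y^T = y -> y + mxsymprod u0 (v y) + mxsymprod (u y) v0 =
     \matrix_(i, j) (if ((i, j) \in J) || ((j, i) \in J) then y i j else 0)) ->
  exists2 e : R, 0 < e & forall A, `|pencil_mx A - base_mx| < e ->
    exists y t, t != 0 /\ pencil A t = mxsymprod (u0 + u y) (v0 + v y).
Proof.
move=> ule vle uv0 uvE.
(* The base solution is the unit matrix at [p0], attained by the base pencil because [p0] lies in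
   [J]. *)
have t0E : vec_mx (base_coord (symunit p0) *m base_mx) = symunit p0.
  rewrite base_coordK; last by apply/matrixP => i j; rewrite !mxE orbC.
  apply/matrixP => i j; rewrite !mxE; case: eqVneq => [->|_] /=; first by rewrite Jp0.
  by case: eqVneq => [->|_]; rewrite ?Jp0 ?orbT // if_same.
have [||||||e e0 eP] := @symprod_perturbation R d m base_mx
    (base_coord (symunit p0)) u0 v0 base_coord u v.
- exact: base_coord_le.
- exact: ule.
- exact: vle.
- apply: contra_eq_neq t0E => ->; rewrite mul0mx linear0 eq_sym.
  apply/eqP => /matrixP/(_ p0.1 p0.2); rewrite !mxE -surjective_pairing eqxx.
  by move/eqP; rewrite oner_eq0.
- by rewrite t0E uv0.
- by move=> y symy; rewrite base_coordK // uvE.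
exists e => // A /eP [||y [t [t0 tE]]].
- by move=> t; apply: tr_vec_mul_symmetric_rows; exact: symmetric_rows_pencil_mx.
- by move=> t; apply: tr_vec_mul_symmetric_rows; exact: symmetric_rows_base.
by exists y, t; split; rewrite ?pencil_mxE.
Qed.

End Base.

Lemma UsetE A : Uset R d m A <-> forall t, t != 0 ->
  exists X : 'M[R]_(2, d), \det (X *m pencil A t *m X^T) != 0.
Proof.
by split=> UA t /UA; rewrite (rank_ge2P (tr_pencil A t)).
Qed.

Lemma UtildeE A : Utilde R d m A <-> forall t, t != 0 ->
  exists X : 'M[R]_(2, d), 0 < \det (X *m pencil A t *m X^T).
Proof.
by split=> UA t /UA; rewrite (two_eigenvaluesP (tr_pencil A t)).
Qed.

Lemma det_congr_scale (X : 'M[R]_(2, d)) (a : R) (M : 'M[R]_d) :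
  \det (X *m (a *: M) *m X^T) = a ^+ 2 * \det (X *m M *m X^T).
Proof. by rewrite -scalemxAr -scalemxAl detZ. Qed.

Lemma Uset_open : open (Uset R d m).
Proof.
rewrite (_ : Uset R d m = [set A : fdspace (symmaps R d m) | forall t, t != 0 ->
    [set M | exists X : 'M[R]_(2, d), [set x : R | x != 0] (\det (X *m M *m X^T))] (pencil A t)]).
  apply: open_forall_pencil; first by apply: open_exists_det_congr; exact: open_neq.
  move=> c M c0 [X /= MX]; exists X => /=.
  by rewrite det_congr_scale mulf_neq0 // expf_neq0.
by apply/seteqP; split => A /UsetE.
Qed.

Lemma Utilde_open : open (Utilde R d m).
Proof.
rewrite (_ : Utilde R d m = [set A : fdspace (symmaps R d m) | forall t, t != 0 ->
    [set M | exists X : 'M[R]_(2, d), [set x : R | 0 < x] (\det (X *m M *m X^T))] (pencil A t)]).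
  apply: open_forall_pencil; first by apply: open_exists_det_congr; exact: open_gt.
  move=> c M c0 [X /= MX]; exists X => /=.
  by rewrite det_congr_scale pmulr_rgt0 // exprn_even_gt0.
by apply/seteqP; split => A /UtildeE.
Qed.

Lemma symprod_not_Utilde A t u v : t != 0 -> pencil A t = mxsymprod u v ->
  ~ Utilde R d m A.
Proof.
move=> t0 tE /UtildeE /(_ _ t0) [X]; rewrite tE ltNge.
by rewrite det_symprod_le0.
Qed.

Lemma square_not_Uset A t (a : R) (v : 'rV[R]_d) : t != 0 -> pencil A t = a *: (v^T *m v) ->
  ~ Uset R d m A.
Proof. by move=> t0 tE /(_ _ t0); rewrite tE ltnNge rank_scaled_square. Qed.

End Pencils.

(** * Emptiness and nonemptiness *)

(** Take u = e_0 and v the first row, with the corner halved because the product counts it twice. *)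
Lemma first_row_symprod (R : realType) d (M : 'M[R]_d.+1) : M^T = M ->
  (forall i j, i != 0 -> j != 0 -> M i j = 0) ->
  exists u v, M = mxsymprod u v.
Proof.
move=> symM M0; exists (delta_mx 0 0), (\row_j (if j == 0 then M 0 0 / 2 else M 0 j)).
have M0C i : M i 0 = M 0 i by rewrite -[in LHS]symM mxE.
apply/matrixP => i j; rewrite !mxE !big_ord1 !mxE !eqxx ?andbT /=.
have [->|i0] := eqVneq i 0; have [->|j0] := eqVneq j 0;
  rewrite ?mulr1 ?mul1r ?mulr0 ?mul0r ?addr0 ?add0r ?M0C //; last exact: M0.
by field.
Qed.

Section Emptiness.
Variables (R : realType) (d m : nat).
Implicit Types (A : symmaps R d.+1 m) (t : 'rV[R]_m).

(** Killing every entry but the corner takes C(d+2,2) - 1 < m equations on t and leaves a matrix of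
    rank at most 1. *)
Lemma Uset_empty : ('C(d.+2, 2) <= m)%N -> Uset R d.+1 m = set0.
Proof.
move=> Nm; apply/seteqP; split => // A UA.
have J0 : (ord0, ord0) \in pairs_from 0 d.+1 by rewrite inE.
have [|t [t0 tJ]] := @pencil_vanish _ _ _ A (pairs_from 0 d.+1 :\ (ord0, ord0)).
  by move: Nm; rewrite -[d.+2]/((d.+1 - 0).+1) -card_pairs_from (cardsD1 (ord0, ord0)) J0.
apply: (@square_not_Uset _ _ _ A t (pencil A t 0 0) (delta_mx 0 0)) => //.
apply/matrixP => i j; rewrite trmx_delta mul_delta_mx [RHS]mxE [X in _ * X]mxE.
have [/andP [/eqP-> /eqP->]|ij] := boolP ((i == 0) && (j == 0)); first by rewrite mulr1.
rewrite mulr0; have [le_ij|/ltnW le_ji] := leqP i j.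
  by apply: (tJ (i, j)); rewrite !inE /= le_ij andbT xpair_eqE.
rewrite -tr_pencil mxE; apply: (tJ (j, i)); rewrite !inE /= le_ji andbT xpair_eqE.
by rewrite andbC.
Qed.

(** Killing the lower right d x d block takes C(d+1,2) < m equations on t, and what remains is a
    symmetric product. *)
Lemma Utilde_empty : ('C(d.+1, 2) < m)%N -> Utilde R d.+1 m = set0.
Proof.
move=> Nm; apply/seteqP; split => // A UA.
have [|t [t0 tJ]] := @pencil_vanish _ _ _ A (pairs_from 1 d.+1).
  by rewrite card_pairs_from subSS subn0.
have tp i j : i != 0 -> j != 0 -> pencil A t i j = 0.
  rewrite -!lt0n => i0 j0; have [le_ij|/ltnW le_ji] := leqP i j.
    by apply: (tJ (i, j)); rewrite inE /= le_ij andbT.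
  by rewrite -tr_pencil mxE; apply: (tJ (j, i)); rewrite inE /= le_ji andbT.
have [u [v tE]] := first_row_symprod (tr_pencil A t) tp.
exact: symprod_not_Utilde t0 tE UA.
Qed.

End Emptiness.

(** The pencil is chosen injective with values of trace zero. A value of rank at most 1 is plus or
    minus v^T v, and zero trace forces v = 0. *)
Lemma Uset_nonempty (R : realType) (d m : nat) :
  (m < 'C(d.+2, 2))%N -> Uset R d.+1 m !=set0.
Proof.
move=> mN; pose J := pairs_from 0 d.+1 :\ (ord0, ord0).
have J0 : (ord0, ord0) \in pairs_from 0 d.+1 by rewrite inE.
have mJ : (m <= #|J|)%N.
  by move: mN; rewrite -[d.+2]/((d.+1 - 0).+1) -card_pairs_from (cardsD1 (ord0, ord0)) J0.
pose f (k : 'I_m) := nth (ord0, ord0) (enum J) k.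
have fJ k : f k \in J by rewrite -mem_enum mem_nth // -cardE (leq_trans (ltn_ord k)).
have f_inj : injective f.
  move=> k l /eqP; rewrite nth_uniq ?enum_uniq -?cardE ?(leq_trans (ltn_ord _)) //.
  by move/eqP/val_inj.
(* Subtracting the corner unit from the diagonal ones makes every trace zero. *)
pose E p : 'M[R]_d.+1 := symunit R p - (p.1 == p.2)%:R *: delta_mx 0 0.
have symE p : (E p)^T = E p.
  apply/matrixP => i j; rewrite !mxE orbC; congr (_ - _ * _%:R).
  by rewrite andbC.
pose B : 'M[R]_(m, d.+1 * d.+1) := \matrix_k mxvec (E (f k)).
have symB : symmetric_rows B by move=> k; rewrite rowK mxvecK symE.
have trE0 p : \tr (E p) = 0.
  have tr0 : \tr (delta_mx 0 0 : 'M[R]_d.+1) = 1.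
    rewrite /mxtrace (bigD1 0) //= mxE big1 ?addr0 // => i i0.
    by rewrite mxE (negPf i0).
  case: p => a b; rewrite linearB linearZ /= tr0 mulr1; case: eqVneq => [->|ab].
    rewrite /mxtrace (bigD1 b) //= mxE eqxx big1 ?addr0 ?subrr // => i ib.
    by rewrite mxE xpair_eqE (negPf ib).
  rewrite /mxtrace big1 ?subrr // => i _; rewrite mxE !xpair_eqE orbb.
  by case: eqVneq => // ->; rewrite (negPf ab).
(* Positions in [J] avoid the corner, so the correction is invisible there and t can be read off the
   entries of the pencil. *)
have EJ p q : p \in J -> q \in J -> E p q.1 q.2 = (p == q)%:R.
  case: p q => [a b] [a' b']; rewrite !inE /= !xpair_eqE => /andP [_ ab] /andP [q0 ab'].
  rewrite !mxE !xpair_eqE (negPf q0) mulr0 subr0 (eq_sym a) (eq_sym b).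
  rewrite orb_idr // => /andP [/eqP b'a /eqP a'b]; rewrite b'a a'b in ab' *.
  have -> : a = b by apply/val_inj/eqP; rewrite eqn_leq ab.
  by rewrite eqxx.
exists (symmap_of B) => t t0 /=.
have tE : pencil (symmap_of B) t = \sum_k t 0 k *: E (f k).
  rewrite pencil_mxE symmap_ofK // mulmx_sum_row linear_sum /=.
  by apply: eq_bigr => k _; rewrite linearZ /= rowK mxvecK.
have trE : \tr (pencil (symmap_of B) t) = 0.
  rewrite tE linear_sum big1 // => k _; rewrite linearZ /=.
  by rewrite trE0 mulr0.
have entry k : pencil (symmap_of B) t (f k).1 (f k).2 = t 0 k.
  rewrite tE summxE (bigD1 k) //= big1 ?addr0 => [|l lk]; rewrite mxE EJ //.
    by rewrite eqxx mulr1.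
  by rewrite (inj_eq f_inj) (negPf lk) mulr0.
rewrite leqNgt ltnS; apply: contra t0 => rank1.
have [X|b [v tv]] := minors_eq0_square (tr_pencil (symmap_of B) t).
  apply/eqP; apply: contraTT rank1 => detX; rewrite -ltnNge.
  by apply/(rank_ge2P (tr_pencil _ _)); exists X.
have v0 : v = 0.
  apply/eqP; apply/negPn/negP => /row_norm_gt0.
  move: trE; rewrite tv linearZ /= mxtrace_mulC => /eqP.
  rewrite mulf_eq0 signr_eq0 /= /mxtrace big_ord1 => /eqP ->.
  by rewrite ltxx.
apply/eqP/rowP => k; rewrite -entry tv v0 mulmx0 scaler0 !mxE //.
Qed.

(** * Failure of density *)

Section NotDense.
Variable R : realType.

Definition masked_row d (c : 'I_d -> R) (i : 'I_d) (y : 'M[R]_d) : 'rV[R]_d :=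
  \row_j (c j * y i j).

Fact masked_row_additive d c i : additive (@masked_row d c i).
Proof. by move=> x y; apply/rowP => j; rewrite !mxE mulrBr. Qed.
HB.instance Definition _ d c i := GRing.isZmodMorphism.Build 'M[R]_d 'rV[R]_d
  (@masked_row d c i) (@masked_row_additive d c i).

Lemma masked_row_le d c i (y : 'M[R]_d) : (forall j, `|c j| <= 1) ->
  `|masked_row c i y| <= `|y|.
Proof.
move=> c1; apply: mx_norm_le => // k j; rewrite mxE normrM.
by rewrite -[leRHS]mul1r ler_pM // mx_entry_le_norm.
Qed.

(** At e_0^T e_0 the tangent directions of the cone of squares fill the first row and column, and
    the base pencil fills the corner and the remaining block. The two are transverse, so nearby
    pencils still meet the cone at some t != 0. *)
Lemma Uset_not_dense d m : ('C(d.+1, 2) < m)%N -> ~ dense (Uset R d.+1 m).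
Proof.
move=> mN; pose p0 : 'I_d.+1 * 'I_d.+1 := (0, 0).
pose J := p0 |: pairs_from 1 d.+1.
have Jm : (#|J| <= m)%N.
  by rewrite cardsU1 inE /= add1n card_pairs_from subSS subn0.
have Jp0 : p0 \in J by rewrite !inE eqxx.
have Jle : J \subset pairs_from 0 d.+1.
  apply/fintype.subsetP => p; rewrite !inE => /orP [/eqP ->//|/andP [_ //]].
(* The corner is carried by the pencil, hence weight 0; elsewhere -1 cancels the first row of y. *)
pose c (j : 'I_d.+1) : R := if j == 0 then 0 else -1.
have c1 j : `|c j| <= 1 by rewrite /c; case: ifP; rewrite ?normr0 ?normrN1.
(* Halving keeps u0 + u y equal to half of v0 + v y, so that the perturbed product is again a
   square. *)
pose v := masked_row c 0; pose u := masked_row (fun j => c j / 2) 0.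
have uE y : u y = 2^-1 *: v y by apply/rowP => j; rewrite !mxE mulrAC mulrC.
have [||||e e0 eP] := @base_perturbation R d.+1 m J p0 Jm Jp0 Jle
    (2^-1 *: delta_mx 0 0) (delta_mx 0 0) u v.
- move=> y; apply: masked_row_le => j; rewrite normrM.
  by have := c1 j; rewrite [ `|2^-1|]ger0_norm; lra.
- by move=> y; apply: masked_row_le.
- apply/matrixP => i j; rewrite !mxE !big_ord1 !mxE !xpair_eqE /= ?andbT.
  by case: (i == 0); case: (j == 0) => /=; field.
- move=> y symy.
  rewrite [mxsymprod _ (delta_mx _ _)](_ : _ = mxsymprod (2^-1 *: v y) (delta_mx 0 0)) -?uE //.
  have y0 i : y i 0 = y 0 i by rewrite -[in LHS]symy mxE.
  apply/matrixP => i j; rewrite !mxE !big_ord1 !mxE !inE !xpair_eqE /= ?andbT.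
  have gt0 (k : 'I_d.+1) : (0 < k)%N = (k != 0) by rewrite lt0n.
  rewrite !gt0 /c; have [->|i0] := eqVneq i 0; have [->|j0] := eqVneq j 0;
    rewrite ?eqxx ?(negPf i0) ?(negPf j0) /= ?y0; try by field.
  - by rewrite leqNgt gt0 j0 /=; field.
  - by rewrite leqNgt gt0 i0 /=; field.
  - by rewrite leq_total /=; field.
apply: (not_dense_near e0 (@symmetric_rows_base R _ m J p0)) => A /eP [y [t [t0 tE]]].
apply: (@square_not_Uset _ _ _ A t 1 (delta_mx 0 0 + v y)) => //.
rewrite tE -[u in mxsymprod (_ + u)]/(u y) uE -scalerDr /mxsymprod.
rewrite [(_ *: _)^T]linearZ /= -scalemxAl -scalemxAr.
by rewrite scale1r -scalerDl (_ : 2^-1 + 2^-1 = 1 :> R) ?scale1r //; field.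
Qed.

(** Same transversality at the product of e_0 and e_1: varying the factors moves the first two rows
    and columns, while the base pencil carries position (0, 1) and the block from index 2 on. *)
Lemma Utilde_not_dense d m : ('C(d.+1, 2) < m)%N -> ~ dense (Utilde R d.+2 m).
Proof.
move=> mN; pose i1 : 'I_d.+2 := Ordinal (isT : (1 < d.+2)%N).
pose p0 : 'I_d.+2 * 'I_d.+2 := (0, i1).
pose J := p0 |: pairs_from 2 d.+2.
have Jm : (#|J| <= m)%N.
  by rewrite cardsU1 inE /= add1n card_pairs_from !subSS subn0.
have Jp0 : p0 \in J by rewrite !inE eqxx.
have Jle : J \subset pairs_from 0 d.+2.
  apply/fintype.subsetP => p; rewrite !inE => /orP [/eqP ->//|/andP [_ //]].
(* [v] corrects row 0 and [u] row 1. The product counts the diagonal entries twice, hence -1/2; the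
   weights 0 leave position (0, 1) to the pencil. *)
pose cv (j : 'I_d.+2) : R := if j == 0 then - 2^-1 else if j == i1 then 0 else -1.
pose cu (j : 'I_d.+2) : R := if j == 0 then 0 else if j == i1 then - 2^-1 else -1.
pose v := masked_row cv 0; pose u := masked_row cu i1.
have half1 : `|- 2^-1 : R| <= 1 by rewrite normrN ger0_norm; lra.
have [||||e e0 eP] := @base_perturbation R d.+2 m J p0 Jm Jp0 Jle
    (delta_mx 0 0) (delta_mx 0 i1) u v.
- move=> y; apply: masked_row_le => j; rewrite /cu.
  by case: ifP; [|case: ifP]; rewrite ?normr0 ?normrN1.
- move=> y; apply: masked_row_le => j; rewrite /cv.
  by case: ifP; [|case: ifP]; rewrite ?normr0 ?normrN1.
- apply/matrixP => i j; rewrite !mxE !big_ord1 !mxE !xpair_eqE /= ?andbT.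
  have [->|_] := eqVneq i 0; have [->|_] := eqVneq j 0; rewrite /= ?mul1r ?mul0r
    ?mulr1 ?mulr0 ?addr0 ?add0r ?andbF ?andbT ?orbF //.
- move=> y symy.
  have yC i j : y i j = y j i by rewrite -[in LHS]symy mxE.
  apply/matrixP => i j; rewrite !mxE !big_ord1 !mxE !inE !xpair_eqE /= ?andbT.
  have gt1 (k : 'I_d.+2) : (1 < k)%N = (k != 0) && (k != i1).
    by case: k => -[|[|k]].
  rewrite !gt1 /cu /cv; have [->|i0] := eqVneq i 0; have [->|j0] := eqVneq j 0;
    rewrite ?eqxx ?(negPf i0) ?(negPf j0) /=; try by field.
  - by rewrite leqn0 -[_ == 0%N]/(j == 0) (negPf j0) andbF orbF; case: (j == i1) => /=; field.
  - rewrite leqn0 -[_ == 0%N]/(i == 0) (negPf i0) andbF (yC i 0).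
    by case: (i == i1) => /=; field.
  have le1 (k : 'I_d.+2) : k != 0 -> (k <= 1)%N = (k == i1).
    by move=> k0; rewrite leqNgt gt1 k0 negbK.
  have [->|ni1] := eqVneq i i1; have [->|nj1] := eqVneq j i1; rewrite /= ?andbF ?orbF.
  - by field.
  - by rewrite le1 // (negPf nj1); field.
  - by rewrite le1 // (negPf ni1) (yC i i1); field.
  - by rewrite leq_total; field.
apply: (not_dense_near e0 (@symmetric_rows_base R _ m J p0)) => A /eP [y [t [t0 tE]]].
exact: symprod_not_Utilde t0 tE.
Qed.
End NotDense.

(** * Algebraic dependence *)

Lemma expansion_inj (D n : nat) (a b : 'I_n -> nat) :
  (forall i, a i < D)%N -> (forall i, b i < D)%N ->
  (\sum_i a i * D ^ i = \sum_i b i * D ^ i)%N -> a =1 b.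
Proof.
elim: n a b => [|n IH] a b aD bD; first by move=> _ [].
rewrite !big_ord_recl /= expn0 !muln1.
have shift (c : 'I_n.+1 -> nat) :
    (\sum_(i < n) c (lift ord0 i) * D ^ bump 0 i =
     (\sum_(i < n) c (lift ord0 i) * D ^ i) * D)%N.
  rewrite big_distrl; apply: eq_bigr => i _.
  by rewrite /= /bump expnS (mulnC D) mulnA.
rewrite !shift => ab.
have D0 : (0 < D)%N := leq_ltn_trans (leq0n _) (aD ord0).
have a0 : a ord0 = b ord0.
  move/(congr1 (modn^~ D)): (ab); rewrite ![(_ + _ * D)%N]addnC !modnMDl.
  by rewrite !modn_small.
have al : (fun i => a (lift ord0 i)) =1 (fun i => b (lift ord0 i)).
  apply: IH => [i|i|]; [exact: aD|exact: bD|].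
  move: ab; rewrite a0 => /addnI /eqP; rewrite eqn_pmul2r // => /eqP; exact.
by move=> i; case: (unliftP ord0 i) => [j ->|->].
Qed.

Section MultivariatePolynomials.
Variable R : realType.

(** The first [size P] of the points e/2, e/3, ... are too many to be all roots. *)
Lemma small_nonroot (P : {poly R}) (e : R) : P != 0 -> 0 < e ->
  exists s, 0 < s < e /\ P.[s] != 0.
Proof.
move=> P0 e0; apply: contrapT => noroot.
pose s (i : nat) : R := e / i.+2%:R.
have s0 i : 0 < s i < e.
  by rewrite divr_gt0 ?ltr0n //= ltr_pdivrMr ?ltr0n // ltr_pMr // ltr1n.
pose rs := [seq s i | i <- iota 0 (size P)].
have : (size rs < size P)%N.
  apply: max_poly_roots P0 _ _.
    apply/allP => x /mapP [i _ ->]; apply: contrapT => si.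
    by apply: noroot; exists (s i); split => //; apply/negP.
  rewrite map_inj_uniq ?iota_uniq // => i j /(mulfI (lt0r_neq0 e0)) /invr_inj /eqP.
  by rewrite eqr_nat => /eqP [].
by rewrite size_map size_iota ltnn.
Qed.

(* Kronecker's substitution [x_i = s ^ (D ^ i)] separates the monomials. *)
Lemma meval_neq0 n (F : mpoly n R) : F != 0 -> exists x, meval x F != 0.
Proof.
move=> F0; pose D := msize F.
have mD m i : m \in msupp F -> (m i < D)%N.
  move=> /msize_mdeg_lt; apply: leq_ltn_trans.
  by rewrite mdegE (bigD1 i) //= leq_addr.
pose k (m : multinom n) := (\sum_i m i * D ^ i)%N.
pose P : {poly R} := \sum_(m <- msupp F) mcoeff m F *: 'X^(k m).
have PE s : P.[s] = meval (fun i : 'I_n => s ^+ (D ^ i)) F.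
  rewrite mevalE horner_sum; apply: eq_bigr => m _.
  rewrite hornerZ hornerXn /k -prodrXr; congr (_ * _).
  by apply: eq_bigr => i _; rewrite mulnC exprM.
have P0 : P != 0.
  have : msupp F != [::] by rewrite msupp_eq0.
  case E : (msupp F) => [//|m0 s] _.
  have m0F : m0 \in msupp F by rewrite E mem_head.
  apply/eqP => /(congr1 (fun p : {poly R} => p`_(k m0))) /eqP.
  rewrite coef0 coef_sum (bigD1_seq m0) ?msupp_uniq //= coefZ coefXn eqxx mulr1.
  rewrite big_seq_cond big1 ?addr0; first by rewrite mcoeff_eq0 m0F.
  move=> m /andP [mF m_m0]; rewrite coefZ coefXn; case: eqP => [kk|_]; rewrite ?mulr0 //.
  case/eqP: m_m0; apply/mnmP; apply: (@expansion_inj D) => [i|i|]; rewrite ?mD //.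
have [s [_ Ps]] := small_nonroot P0 ltr01.
by exists (fun i : 'I_n => s ^+ (D ^ i)); rewrite -PE.
Qed.

(** A crude degree bound; what matters is that it grows linearly in [D]. *)
Lemma msize_prod_exp n p (q : 'I_n -> mpoly p R) (a : 'I_n -> nat) e D :
  (forall i, msize (q i) <= e)%N -> (forall i, a i < D)%N ->
  (msize (\prod_i q i ^+ a i) <= n * (D * e.+1 + 1) + 1)%N.
Proof.
move=> qe aD; have powle (i : 'I_n) c : (msize (q i ^+ c) <= c * e.+1 + 1)%N.
  elim: c => [|c IH]; first by rewrite expr0 msize1.
  rewrite exprS (leq_trans (msizeM_le _ _)) // mulSn.
  by have := leq_add (qe i) IH; lia.
have -> : (n * (D * e.+1 + 1) = \sum_(i < n) (D * e.+1 + 1))%N.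
  by rewrite sum_nat_const card_ord.
elim/big_rec2: _ => [|i s x _ IH]; first by rewrite msize1.
rewrite (leq_trans (msizeM_le _ _)) //.
have := leq_add (powle i (a i)) IH.
have : ((a i).+1 * e.+1 <= D * e.+1)%N by rewrite leq_mul2r aD orbT.
rewrite mulSn; lia.
Qed.

(* Monomials of degree < D in each of the n unknowns outnumber the monomials
   of degree < L * D in p < n unknowns once D > L ^ p. *)
Lemma algebraically_dependent n p (q : 'I_n -> mpoly p R) : (p < n)%N ->
  exists F : mpoly n R, F != 0 /\ forall x, meval (fun i => meval x (q i)) F = 0.
Proof.
move=> pn; pose e := (\max_i msize (q i))%N.
have qe i : (msize (q i) <= e)%N by exact: leq_bigmax.
pose L := (n * (e + 2) + 1)%N; pose D := (L ^ p + 1)%N; pose K := (L * D)%N.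
have D0 : (0 < D)%N by rewrite /D addn1.
have KD : (K ^ p < D ^ n)%N.
  apply: leq_trans (leq_pexp2l D0 pn).
  by rewrite /K expnMn expnS ltn_mul2r expn_gt0 D0 /= /D addn1.
pose mon r (b : nat) (f : {ffun 'I_r -> 'I_b}) : multinom r :=
  Multinom (mktuple (fun i => f i : nat)).
have monE r b (f : {ffun 'I_r -> 'I_b}) i : mon r b f i = f i :> nat by rewrite mnmE.
pose g (f : {ffun 'I_n -> 'I_D}) : mpoly p R := \prod_i q i ^+ f i.
have gK f : (msize (g f) <= K)%N.
  rewrite (leq_trans (msize_prod_exp qe (fun i => ltn_ord (f i)))) // /K /L.
  nia.
(* Each row lists the coefficients of one product of powers of the q_i; there are more rows than
   columns, and a left kernel vector gives the coefficients of [F]. *)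
pose C : 'M[R]_(#|{ffun 'I_n -> 'I_D}|, #|{ffun 'I_p -> 'I_K}|) :=
  \matrix_(i, j) mcoeff (mon _ _ (enum_val j)) (g (enum_val i)).
have : kermx C != 0.
  rewrite kermx_eq0 /row_free neq_ltn (leq_ltn_trans (rank_leq_col _)) //.
  by rewrite !card_ffun !card_ord.
move=> /rowV0Pn [c /sub_kermxP cC c0].
pose F : mpoly n R := \sum_i c 0 i *: mpolyX R (mon _ _ (enum_val i)).
have G0 : \sum_i c 0 i *: g (enum_val i) = 0.
  apply/mpolyP => m; rewrite mcoeff0 raddf_sum /=.
  have [mK|] := pselect (forall i, m i < K)%N; last first.
    move=> /existsNP [i /negP]; rewrite -leqNgt => Ki.
    apply: big1 => j _; rewrite mcoeffZ memN_msupp_eq0 ?mulr0 //.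
    rewrite msize_mdeg_ge // (leq_trans (gK _)) // (leq_trans Ki) //.
    by rewrite mdegE (bigD1 i) //= leq_addr.
  pose f : {ffun 'I_p -> 'I_K} := [ffun i => Ordinal (mK i)].
  have mf : m = mon _ _ f by apply/mnmP => i; rewrite monE ffunE.
  move/rowP/(_ (enum_rank f)): cC; rewrite mxE [RHS]mxE => cCf.
  rewrite -[RHS]cCf.
  by apply: eq_bigr => j _; rewrite [C _ _]mxE enum_rankK -mf mcoeffZ.
exists F; split.
  have /rV0Pn [k ck] := c0.
  apply: contraNneq ck => /(congr1 (mcoeff (mon _ _ (enum_val k)))).
  rewrite mcoeff0 raddf_sum (bigD1 k) //= mcoeffZ mcoeffX eqxx mulr1.
  rewrite big1 ?addr0 => [->//|l lk]; rewrite mcoeffZ mcoeffX.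
  case: eqP => [monkl|_]; rewrite ?mulr0 //.
  case/eqP: lk; apply: enum_val_inj; apply/ffunP => i; apply/val_inj.
  by rewrite /= -!monE monkl.
move=> x; rewrite raddf_sum /= -[RHS](meval0 x) -G0 raddf_sum /=.
apply: eq_bigr => i _; rewrite !mevalZ mevalX; congr (_ * _).
rewrite rmorph_prod; apply: eq_bigr => j _; rewrite rmorphXn /= monE //.
Qed.
End MultivariatePolynomials.

(** * Hypersurfaces and the density of their complements *)

Section Generic.
Variables (R : realType) (V : vectType R).
Local Notation n := (\dim {:V}).

Lemma coords_surj (x : 'rV[R]_n) : exists v : V, coords v = x.
Proof.
exists (\sum_i x 0 i *: (vbasis {:V})`_i); apply/rowP => i; rewrite mxE.
by rewrite coord_sum_free // (basis_free (vbasisP _)).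
Qed.

(** On the line through x and y, [F] restricts to a univariate polynomial that is nonzero at s =
    1. *)
Lemma mpoly_line_neq0 (F : mpoly n R) (x y : 'rV[R]_n) (e : R) :
  meval (y 0) F != 0 -> 0 < e ->
  exists s, 0 < s < e /\ meval ((x + s *: (y - x)) 0) F != 0.
Proof.
move=> Fy e0; pose P : {poly R} := \sum_(m <- msupp F)
  mcoeff m F *: \prod_i ((x 0 i)%:P + (y 0 i - x 0 i) *: 'X) ^+ (m : multinom n) i.
have PE s : P.[s] = meval ((x + s *: (y - x)) 0) F.
  rewrite mevalE horner_sum; apply: eq_bigr => m _.
  rewrite hornerZ horner_prod; congr (_ * _); apply: eq_bigr => i _.
  by rewrite !hornerE !mxE; congr (_ ^+ _); ring.
have P0 : P != 0.
  apply: contraNneq Fy => P0; have := PE 1.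
  by rewrite P0 horner0 scale1r subrKC => <-.
have [s [se Ps]] := small_nonroot P0 e0.
by exists s; rewrite -PE.
Qed.

(** From any point, a small step towards a fixed point where [F] is nonzero leaves the zero locus of
    [F]; that fixed point also shows the locus to be proper. *)
Lemma generic_dense (W : set (fdspace V)) (F : mpoly n R) : F != 0 ->
  (forall v : V, meval (coords v 0) F != 0 -> W v) ->
  dense W /\ exists2 Z : set V, proper_algebraic_subset Z & ~` W `<=` Z.
Proof.
move=> F0 FW; have [y0 Fy0] := meval_neq0 F0.
pose y : 'rV[R]_n := \row_i y0 i.
have Fy : meval (y 0) F != 0 by rewrite (meval_eq _ (v2 := y0)) // => i; rewrite mxE.
split.
  move=> A [v Av] [U oU UA]; move: Av; rewrite -UA => Uv.
  have /nbhs_ballP [e /= e0 eU] : nbhs (coords v) U by exact: open_nbhs_nbhs.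
  have d0 : 0 < `|y - coords v| + 1 by rewrite ltr_wpDl.
  have [s [/andP [s0 se] Fs]] := mpoly_line_neq0 (coords v) Fy (divr_gt0 e0 d0).
  have [w wE] := coords_surj (coords v + s *: (y - coords v)).
  exists w; split; last by apply: FW; rewrite wE.
  apply: eU; rewrite wE mx_norm_ball /= opprD addNKr normrN normrZ gtr0_norm //.
  rewrite ltr_pdivlMr // in se; apply: le_lt_trans se.
  by rewrite ler_pM2l // lerDl.
exists (zero_locus [set F]).
  split; first by exists [set F].
  have [w wy] := coords_surj y.
  apply/eqP => ZT; have : zero_locus [set F] w by rewrite ZT.
  by move=> /(_ F erefl); rewrite wy; apply/eqP.
move=> v nWv _ ->; apply/eqP/negPn/negP => /FW; exact: nWv.
Qed.
End Generic.

Section PolynomialFunctions.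
Variables (R : realType) (I : finType).

(** Variables are indexed by an arbitrary finite type, so that parameter spaces can be built as sum
    types. *)
Definition polynomial_fun (f : (I -> R) -> R) :=
  exists q : mpoly #|I| R, forall x, f x = meval (x \o enum_val) q.

Lemma polynomial_fun_cst a : polynomial_fun (fun=> a).
Proof. by exists (mpolyC _ a) => x; rewrite mevalC. Qed.

Lemma polynomial_fun_var i : polynomial_fun (fun x => x i).
Proof. by exists (mpolyX R (mnm1 (enum_rank i))) => x; rewrite mevalXU /= enum_rankK. Qed.

Lemma polynomial_funD f g :
  polynomial_fun f -> polynomial_fun g -> polynomial_fun (fun x => f x + g x).
Proof. by move=> [p fp] [q gq]; exists (p + q) => x; rewrite mevalD fp gq. Qed.

Lemma polynomial_funM f g :
  polynomial_fun f -> polynomial_fun g -> polynomial_fun (fun x => f x * g x).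
Proof. by move=> [p fp] [q gq]; exists (p * q) => x; rewrite mevalM fp gq. Qed.

Lemma polynomial_fun_sum (J : Type) (r : seq J) (P : pred J) f :
  (forall j, P j -> polynomial_fun (f j)) -> polynomial_fun (fun x => \sum_(j <- r | P j) f j x).
Proof.
move=> pf; elim: r => [|j r IH].
  by have [q qE] := polynomial_fun_cst 0; exists q => x; rewrite big_nil -qE.
have [Pj|nPj] := boolP (P j).
  have [q qE] := polynomial_funD (pf j Pj) IH.
  by exists q => x; rewrite big_cons Pj qE.
by have [q qE] := IH; exists q => x; rewrite big_cons (negPf nPj) qE.
Qed.
End PolynomialFunctions.

Lemma polynomial_image_hypersurface (R : realType) (V : vectType R) (I : finType)
    (g : (I -> R) -> V) :
  (#|I| < \dim {:V})%N -> (forall i, polynomial_fun (fun x => coords (g x) 0 i)) ->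
  exists F : mpoly (\dim {:V}) R, F != 0 /\ forall x, meval (coords (g x) 0) F = 0.
Proof.
move=> IV /choice [q qE]; have [F [F0 FE]] := algebraically_dependent q IV.
exists F; split => // x; rewrite -(FE (x \o enum_val)).
by apply: meval_eq => i; rewrite qE.
Qed.

(** The product of one equation per chart vanishes on every image. *)
Lemma generic_of_images (R : realType) (V : vectType R) (K : finType)
    (I : K -> finType) (g : forall k, (I k -> R) -> V) (W : set (fdspace V)) :
  (forall k, #|I k| < \dim {:V})%N ->
  (forall k i, polynomial_fun (fun x => coords (g k x) 0 i)) ->
  (forall v : V, ~ W v -> exists k x, v = g k x) ->
  dense W /\ exists2 Z : set V, proper_algebraic_subset Z & ~` W `<=` Z.
Proof.
move=> IV pg cover.
have /choice [F FE] : forall k, exists F : mpoly (\dim {:V}) R,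
    F != 0 /\ forall x, meval (coords (g k x) 0) F = 0.
  by move=> k; exact: polynomial_image_hypersurface.
apply: (@generic_dense _ _ _ (\prod_k F k)).
  by apply/prodf_neq0 => k _; case: (FE k).
move=> v Fv; apply: contrapT => /cover [k [x vE]].
case/eqP: Fv; rewrite rmorph_prod /= (bigD1 k) //= vE.
by have [_ ->] := FE k; rewrite mul0r.
Qed.

(** * Polynomial charts on the bad sets *)

Lemma coords_linear_expand (R : realType) (V : vectType R) p q
    (f : 'Hom('M[R]_(p, q), V)) (B : 'M[R]_(p, q)) i :
  coords (f B) 0 i = \sum_k \sum_l B k l * coords (f (delta_mx k l)) 0 i.
Proof.
rewrite [in LHS](matrix_sum_delta B) mxE !linear_sum; apply: eq_bigr => k _.
by rewrite !linear_sum; apply: eq_bigr => l _; rewrite !linearZ mxE.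
Qed.

Section SymmetricCoordinates.
Variables (R : realType) (d : nat).
Local Notation J := (pairs_from 0 d.+1).
Local Notation N := #|pairs_from 0 d.+1|.
Local Notation p0 := ((0, 0) : 'I_d.+1 * 'I_d.+1).

(** With all positions on or above the diagonal the base pencil is a basis, so [sym_coord] and
    [sym_mx] give inverse coordinates on symmetric matrices. *)
Definition sym_mx : 'M[R]_(N, d.+1 * d.+1) := base_mx R N J p0.
Definition sym_coord (M : 'M[R]_d.+1) : 'rV[R]_N := base_coord N J p0 M.

Lemma sym_coordK M : M^T = M -> sym_coord M *m sym_mx = mxvec M.
Proof.
move=> symM; apply: (can_inj vec_mxK); rewrite mxvecK base_coordK //.
apply/matrixP => i j; rewrite mxE !inE /=.
by rewrite leq_total.
Qed.

Lemma sym_mxK c : sym_coord (vec_mx (c *m sym_mx)) = c.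
Proof.
apply/rowP => k; rewrite mxE ltn_ord mulmx_sum_row linear_sum summxE.
pose f (k : 'I_N) := nth p0 (enum J) k.
have fJ l : f l \in J by rewrite -mem_enum mem_nth // -cardE.
have f_inj : injective f.
  by move=> a b /eqP; rewrite nth_uniq ?enum_uniq -?cardE // => /eqP/val_inj.
rewrite (bigD1 k) //= linearZ /= rowK ltn_ord mxvecK mxE [symunit _ _ _ _]mxE.
rewrite -surjective_pairing eqxx mulr1 big1 ?addr0 // => l lk.
rewrite linearZ /= rowK ltn_ord mxvecK mxE [symunit _ _ _ _]mxE.
rewrite -surjective_pairing -/(f k) -/(f l) (inj_eq f_inj) eq_sym (negPf lk) /=.
case: eqP => [fkl|_]; last by rewrite mulr0.
move: (fJ l) (fJ k); rewrite -fkl !inE /= => lek kle.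
case/eqP: lk; apply: f_inj; rewrite -fkl [RHS]surjective_pairing.
by congr (_, _); apply/val_inj/eqP; rewrite eqn_leq lek kle.
Qed.

(** Tuples of m symmetric matrices inject into the maps, since [pencil_mx] recovers them; the
    parameter count uses this lower bound. *)
Lemma dim_symmaps m : (m * N <= \dim {:symmaps R d.+1 m})%N.
Proof.
pose f : 'Hom('M[R]_(m, N), symmaps R d.+1 m) :=
  linfun (@symmap_of R d.+1 m \o mulmxr sym_mx).
have symC (C : 'M[R]_(m, N)) : symmetric_rows (C *m sym_mx).
  move=> k; rewrite row_mul; apply: tr_vec_mul_symmetric_rows.
  exact: symmetric_rows_base.
have f0 : lker f == 0%VS.
  apply/lker0P => C C'; rewrite !lfunE /= => /(congr1 (@pencil_mx R d.+1 m)).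
  rewrite !symmap_ofK // => CS; apply/row_matrixP => k.
  by rewrite -[LHS]sym_mxK -row_mul CS row_mul sym_mxK.
have <- : \dim {:'M[R]_(m, N)} = (m * N)%N by rewrite dimvf; exact: dim_matrix.
rewrite -(@limg_dim_eq _ _ _ f fullv).
  exact: dimvS (subvf _).
by rewrite (eqP f0) capv0.
Qed.
End SymmetricCoordinates.

Lemma polynomial_fun_comp (R : realType) (I Y : finType) (h : Y -> I) f :
  polynomial_fun f -> polynomial_fun (fun x : I -> R => f (x \o h)).
Proof.
move=> [q qE]; exists (comp_mpoly
  (mktuple (fun j => mpolyX R (mnm1 (enum_rank (h (enum_val j)))))) q) => x.
rewrite qE comp_mpoly_meval; apply: meval_eq => j.
by rewrite tnth_mktuple mevalXU /= enum_rankK.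
Qed.

Section GenericPencils.
Variables (R : realType) (d m : nat).
Local Notation N := #|pairs_from 0 d.+1|.

Section Chart.
Variables (k : 'I_m) (Y : finType) (M : (Y -> R) -> 'M[R]_d.+1).
(** The three summands: coordinates of the matrices P_l with l != k, weights t_l with l != k, and
    parameters of the bad matrix. *)
Definition chart_index : finType :=
  (({l : 'I_m | l != k} * 'I_N + {l : 'I_m | l != k}) + Y)%type.
Implicit Type x : chart_index -> R.

Definition chart_coord x (l : 'I_m) : 'rV[R]_N :=
  \row_q oapp (fun l' => x (inl (inl (l', q)))) 0 (insub l).
Definition chart_weight x (l : 'I_m) : R :=
  oapp (fun l' => x (inl (inr l'))) 0 (insub l).

(* The k-th matrix is solved for from [sum_l w_l P_l = M y] with [w_k = 1];
   [chart_weight] is 0 at k. *)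
Definition chart_mx x : 'M[R]_(m, d.+1 * d.+1) :=
  \matrix_l (if l == k
    then mxvec (M (x \o inr)) - \sum_l' chart_weight x l' *: (chart_coord x l' *m sym_mx R d)
    else chart_coord x l *m sym_mx R d).

Definition chart x : symmaps R d.+1 m := symmap_of (chart_mx x).

Lemma card_chart_index : #|chart_index| = (m.-1 * N + m.-1 + #|Y|)%N.
Proof.
rewrite !card_sum card_prod card_ord card_sig.
by rewrite (eq_card (B := predC1 k)) // cardC1 card_ord.
Qed.

Lemma polynomial_chart_coord l q : polynomial_fun (fun x => chart_coord x l 0 q).
Proof.
have -> : (fun x => chart_coord x l 0 q) =
    (fun x => oapp (fun l' => x (inl (inl (l', q)))) 0 (insub l)).
  by apply/funext => x; rewrite mxE.
case: insubP => [l' _ _|_] /=; last exact: polynomial_fun_cst.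
exact: polynomial_fun_var.
Qed.

Lemma polynomial_chart_weight l : polynomial_fun (fun x => chart_weight x l).
Proof.
rewrite /chart_weight; case: insubP => [l' _ _|_] /=; last exact: polynomial_fun_cst.
exact: polynomial_fun_var.
Qed.

Lemma polynomial_chart_row l q :
  polynomial_fun (fun x => (chart_coord x l *m sym_mx R d) 0 q).
Proof.
have -> : (fun x => (chart_coord x l *m sym_mx R d) 0 q) =
    (fun x => \sum_j chart_coord x l 0 j * sym_mx R d j q).
  by apply/funext => x; rewrite mxE.
apply: polynomial_fun_sum => j _; apply: polynomial_funM.
  exact: polynomial_chart_coord.
exact: polynomial_fun_cst.
Qed.

Hypothesis polyM : forall i j, polynomial_fun (fun y => M y i j).

Lemma polynomial_chart i : polynomial_fun (fun x => coords (chart x) 0 i).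
Proof.
have -> : (fun x => coords (chart x) 0 i) = (fun x => \sum_l \sum_q
    chart_mx x l q * coords (symmap_of (delta_mx l q : 'M[R]_(m, d.+1 * d.+1))) 0 i).
  apply/funext => x; pose f := linfun (@symmap_of R d.+1 m).
  have fE B : f B = symmap_of B by rewrite lfunE.
  rewrite /chart -fE coords_linear_expand.
  by apply: eq_bigr => l _; apply: eq_bigr => q _; rewrite fE.
apply: polynomial_fun_sum => l _; apply: polynomial_fun_sum => q _.
apply: polynomial_funM; last exact: polynomial_fun_cst.
have [lk|lk] := boolP (l == k); last first.
  have -> : (fun x => chart_mx x l q) = (fun x => (chart_coord x l *m sym_mx R d) 0 q).
    by apply/funext => x; rewrite [LHS]mxE (negPf lk).
  exact: polynomial_chart_row.
have -> : (fun x => chart_mx x l q) = (fun x => mxvec (M (x \o inr)) 0 q +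
    (-1) * \sum_l' chart_weight x l' * (chart_coord x l' *m sym_mx R d) 0 q).
  apply/funext => x; rewrite [LHS]mxE lk [LHS]mxE [X in _ + X]mxE summxE mulN1r.
  by congr (_ - _); apply: eq_bigr => l' _; rewrite [LHS]mxE.
apply: polynomial_funD.
  case/mxvec_indexP: q => a b.
  have -> : (fun x => mxvec (M (x \o inr)) 0 (mxvec_index a b)) =
      (fun x => (fun y => M y a b) (x \o inr)) by apply/funext => x; rewrite mxvecE.
  exact: (@polynomial_fun_comp _ _ _ inr (fun y => M y a b) (polyM a b)).
apply: polynomial_funM; first exact: polynomial_fun_cst.
apply: polynomial_fun_sum => l' _; apply: polynomial_funM.
  exact: polynomial_chart_weight.
exact: polynomial_chart_row.
Qed.

(** The equation sum_l t_l P_l = M y determines P_k because t_k = 1; the other parameters are read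
    off from [A] and [t]. *)
Lemma chart_cover (A : symmaps R d.+1 m) (t : 'rV[R]_m) (y : Y -> R) :
   t 0 k = 1 -> pencil A t = M y -> exists x, A = chart x.
Proof.
move=> tk tM.
pose x (c : chart_index) := match c with
  | inl (inl (l, q)) => sym_coord (vec_mx (row (val l) (pencil_mx A))) 0 q
  | inl (inr l) => t 0 (val l)
  | inr b => y b
  end.
exists x; rewrite /chart -[LHS]pencil_mxK; congr symmap_of.
have xrow l : l != k -> chart_coord x l *m sym_mx R d = row l (pencil_mx A).
  move=> lk; rewrite -[RHS]vec_mxK -sym_coordK ?symmetric_rows_pencil_mx //.
  by congr (_ *m _); apply/rowP => q; rewrite [LHS]mxE insubT.
apply/row_matrixP => l; rewrite [RHS]rowK; case: (eqVneq l k) => [->|lk]; last by rewrite xrow.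
have -> : x \o inr = y by [].
rewrite -tM pencil_mxE vec_mxK mulmx_sum_row (bigD1 k) //= tk scale1r.
rewrite [X in _ - X](bigD1 k) //= /chart_weight insubF ?eqxx //= scale0r add0r.
rewrite [X in _ - X](_ : _ = \sum_(l < m | l != k) t 0 l *: row l (pencil_mx A)).
  by rewrite addrK.
by apply: eq_bigr => l' lk; rewrite xrow // insubT.
Qed.
End Chart.

(** Stability of [bad] under scaling lets some t_k be normalised to 1, so finitely many charts
    suffice. With N = C(d+2,2), a chart has (m - 1)N + (m - 1) + |Y| parameters, fewer than mN
    exactly when m + |Y| <= N. *)
Lemma generic_pencils (W : set (fdspace (symmaps R d.+1 m))) (K : finType)
    (Y : K -> finType) (M : forall c, (Y c -> R) -> 'M[R]_d.+1) (bad : set 'M[R]_d.+1) :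
  (forall c, m + #|Y c| <= 'C(d.+2, 2))%N ->
  (forall c i j, polynomial_fun (fun y => M c y i j)) ->
  (forall a P, bad P -> bad (a *: P)) ->
  (forall P, bad P -> exists c y, P = M c y) ->
  (forall A, ~ W A -> exists t, t != 0 /\ bad (pencil A t)) ->
  dense W /\ exists2 Z : set (symmaps R d.+1 m), proper_algebraic_subset Z & ~` W `<=` Z.
Proof.
move=> cardY polyM badZ badM Wbad.
apply: (@generic_of_images R _ ('I_m * K)%type (fun kc => chart_index kc.1 (Y kc.2))
  (fun kc => chart (M kc.2))).
- move=> [k c] /=; apply: leq_trans (dim_symmaps R d m).
  rewrite card_chart_index; have := cardY c; rewrite -[d.+2]/((d.+1 - 0).+1).
  rewrite -card_pairs_from; case: (m) k => [[]//|m' _] /=.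
  by rewrite mulSn; lia.
- by move=> [k c] i; exact: polynomial_chart.
move=> A /Wbad [t [/rV0Pn [k tk] bt]].
have [c [y ty]] := badM _ (badZ (t 0 k)^-1 _ bt).
have [||x xE] := @chart_cover k (Y c) (M c) A ((t 0 k)^-1 *: t) y.
- by rewrite mxE mulVf.
- by rewrite -ty !pencil_mxE -scalemxAl linearZ.
by exists (k, c), x.
Qed.
End GenericPencils.

(** Serves to normalise a nonzero entry of u to 1, which saves one parameter. *)
Lemma symprod_scale (R : realType) d (a : R) (u v : 'rV[R]_d) : a != 0 ->
  mxsymprod u v = mxsymprod (a^-1 *: u) (a *: v).
Proof.
move=> a0; rewrite /mxsymprod ![(_ *: _)^T]linearZ /= -!scalemxAl -!scalemxAr !scalerA.
by rewrite mulVf // mulfV // !scale1r.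
Qed.

(** * Density for small m, by counting parameters *)

Section Genericity.
Variables (R : realType) (d m : nat).

(** Bad matrices are plus or minus v^T v, with d + 1 parameters for each sign, and C(d+2,2) - (d+1)
    = C(d+1,2). *)
Lemma Uset_generic : (m <= 'C(d.+1, 2))%N ->
  dense (Uset R d.+1 m) /\ exists2 Z : set (symmaps R d.+1 m),
    proper_algebraic_subset Z & ~` Uset R d.+1 m `<=` Z.
Proof.
move=> md; pose M (b : bool) (y : 'I_d.+1 -> R) : 'M[R]_d.+1 :=
  (-1) ^+ b *: ((\row_i y i)^T *m (\row_i y i)).
apply: (@generic_pencils R d m _ bool (fun=> 'I_d.+1) M
  [set P | P^T = P /\ forall X : 'M[R]_(2, d.+1), \det (X *m P *m X^T) = 0]).
- by move=> _; rewrite card_ord [leqRHS]binS bin1 leq_add2r.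
- move=> b i j; have -> : (fun y => M b y i j) = (fun y => (-1) ^+ b * (y i * y j)).
    by apply/funext => y; rewrite !mxE big_ord1 !mxE.
  apply: polynomial_funM; first exact: polynomial_fun_cst.
  by apply: polynomial_funM; exact: polynomial_fun_var.
- move=> a P [symP P0]; split; first by rewrite linearZ /= symP.
  by move=> X; rewrite det_congr_scale P0 mulr0.
- move=> P [symP P0]; have [b [v ->]] := minors_eq0_square symP P0.
  exists b, (v 0); rewrite /M (_ : \row_i v 0 i = v) //.
  by apply/rowP => i; rewrite mxE.
move=> A; apply: contra_notP => noA; apply/UsetE => t t0; apply: contrapT => noX.
apply: noA; exists t; split => //; split; first exact: tr_pencil.
move=> X; apply/eqP; apply: contrapT => /negP detX.
by apply: noX; exists X.
Qed.

(** Bad matrices are symmetric products of u and v; with one entry of u normalised to 1 they take d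
    + (d+1) parameters, and C(d+2,2) - (2d+1) = C(d,2). *)
Lemma Utilde_generic : (m <= 'C(d, 2))%N ->
  dense (Utilde R d.+1 m) /\ exists2 Z : set (symmaps R d.+1 m),
    proper_algebraic_subset Z & ~` Utilde R d.+1 m `<=` Z.
Proof.
move=> md; pose Y (i : 'I_d.+1) : finType := ({j : 'I_d.+1 | j != i} + 'I_d.+1)%type.
(* The default 1 is the normalised i-th entry. *)
pose U i (y : Y i -> R) : 'rV[R]_d.+1 :=
  \row_j oapp (fun j' => y (inl j')) 1 (insub j).
pose M i (y : Y i -> R) : 'M[R]_d.+1 := mxsymprod (U i y) (\row_j y (inr j)).
apply: (@generic_pencils R d m _ 'I_d.+1 Y M
  [set P | P^T = P /\ forall X : 'M[R]_(2, d.+1), \det (X *m P *m X^T) <= 0]).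
- move=> i; rewrite card_sum card_ord card_sig (eq_card (B := predC1 i)) //.
  rewrite cardC1 card_ord /= [leqRHS]binS bin1 binS bin1.
  by rewrite addnA !leq_add2r.
- move=> i a b.
  have polyU j : polynomial_fun (fun y => U i y 0 j).
    have -> : (fun y => U i y 0 j) = (fun y => oapp (fun j' => y (inl j')) 1 (insub j)).
      by apply/funext => y; rewrite mxE.
    case: insubP => [j' _ _|_] /=; last exact: polynomial_fun_cst.
    exact: polynomial_fun_var.
  have -> : (fun y => M i y a b) =
      (fun y => U i y 0 a * y (inr b) + y (inr a) * U i y 0 b).
    by apply/funext => y; rewrite [LHS]mxE !mxE !big_ord1 !mxE.
  by apply: polynomial_funD; apply: polynomial_funM => //; exact: polynomial_fun_var.
- move=> a P [symP P0]; split; first by rewrite linearZ /= symP.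
  by move=> X; rewrite det_congr_scale mulr_ge0_le0 ?sqr_ge0.
- move=> P [symP P0]; have [u [v PE]] := minors_le0_symprod symP P0.
  have [u0|/rV0Pn [i ui]] := eqVneq u 0.
    (* The zero matrix is reached in the chart of index 0 with v = 0. *)
    pose y (c : Y 0) : R := 0.
    exists 0, y; rewrite PE u0 /M (_ : \row_j y (inr j) = 0).
      by rewrite /mxsymprod !trmx0 !mul0mx !mulmx0.
    by apply/rowP => j; rewrite !mxE.
  pose y (c : Y i) := match c with
    | inl j => u 0 (val j) / u 0 i
    | inr j => u 0 i * v 0 j
    end.
  exists i, y; rewrite PE -/(mxsymprod u v) (symprod_scale _ _ ui) /M.
  congr mxsymprod; apply/rowP => j; rewrite !mxE //.
  by case: insubP => [j' _ <-|/negPn/eqP ->] /=; rewrite ?mulVf // mulrC.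
move=> A; apply: contra_notP => noA; apply/UtildeE => t t0; apply: contrapT => noX.
apply: noA; exists t; split => //; split; first exact: tr_pencil.
by move=> X; rewrite leNgt; apply/negP => detX; apply: noX; exists X.
Qed.
End Genericity.

Lemma not_dense_set0 (R : realType) (V : vectType R) : ~ dense (set0 : set (fdspace V)).
Proof.
move=> /(_ setT) [||v [_ []]]; first by exists (0 : V).
exact: openT.
Qed.

Local Close Scope ring_scope.

Theorem theorem5p1 (R : realType) (d m : nat) (hd : (0 < d)%N) :
  let U := Uset R d m in
  let Ut := Utilde R d m in
  open U /\ open Ut /\
  (('C(d.+1, 2) <= m)%N -> U = set0) /\
  ((m < 'C(d.+1, 2))%N -> U !=set0) /\
  (('C(d, 2) < m)%N -> ~ dense U) /\
  ((m <= 'C(d, 2))%N ->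
     dense U /\ exists2 Z : set (symmaps R d m),
       proper_algebraic_subset Z & ~` U `<=` Z) /\
  (('C(d, 2) < m)%N -> Ut = set0) /\
  (('C(d.-1, 2) < m)%N -> ~ dense Ut) /\
  ((m <= 'C(d.-1, 2))%N ->
     dense Ut /\ exists2 Z : set (symmaps R d m),
       proper_algebraic_subset Z & ~` Ut `<=` Z).
Proof.
case: d hd => // d _ U Ut.
split; first exact: Uset_open.
split; first exact: Utilde_open.
split; first exact: Uset_empty.
split; first exact: Uset_nonempty.
split; first exact: Uset_not_dense.
split; first exact: Uset_generic.
split; first exact: Utilde_empty.
split; last exact: Utilde_generic.
(* In dimension 1 there is no second basis vector for the transversality argument, but there m > 0
   already makes the set empty, hence not dense. *)
rewrite /Ut; case: (d) => [m0|d']; last exact: Utilde_not_dense.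
by rewrite Utilde_empty //; exact: not_dense_set0.
Qed.
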